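(* The sequence $(\sqrt3\,S_j)_{j\in\mathbb N}$ is a Riesz basis of the real Hilbert space $L_2(0,1)$ with Riesz constants \[ A:=\left\{\frac{4\sqrt6}{\pi^2}\left(2-\frac{\pi^2}{8}\right)\right\}^2=0.5787\dots\qquad\text{and}\qquad B:=\frac32 . \]
   Context: Let $S(t)=2t$ for $0\le t\le \frac12$ and $S(t)=2(1-t)$ for $\frac12<t\le 1$, and extend $S$ to $\mathbb R$ by $S(t)=(-1)^{\lfloor t\rfloor}S(t-\lfloor t\rfloor)$ (so $S$ is odd and $2$-periodic). For $j\in\mathbb N=\{1,2,\dots\}$ put $S_j(t)=S(jt)$, regarded as a function on $(0,1)$. A sequence $(\varphi_j)_{j=1}^\infty$ in a Hilbert space $H$ is a Riesz basis with Riesz constants $0<A\le B<\infty$ if $A\sum_{j}\alpha_j^2\le\left\|\sum_{j}\alpha_j\varphi_j\right\|^2\le B\sum_j\alpha_j^2$ for every square-summable real sequence $(\alpha_j)_{j=1}^\infty$, and the closed linear span of $(\varphi_j)$ is $H$. (The Riesz constants are not required to be optimal.) *)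

(* Defs.v *)
From HB Require Import structures.
From mathcomp Require Import all_boot all_order all_algebra.
From mathcomp Require Import all_classical all_reals all_analysis.
From mathcomp Require Import measurable_realfun lra.
Set Implicit Arguments.
Unset Strict Implicit.
Unset Printing Implicit Defensive.
Import Order.TTheory GRing.Theory Num.Theory.
Import numFieldNormedType.Exports.

Local Open Scope classical_set_scope.
Local Open Scope ring_scope.

(* [nrm] may be a seminorm, in which case these definitions express the
   corresponding notions in the quotient of [V] by the kernel of [nrm].
   Sequences are indexed from 0: [phi j] stands for \varphi_{j+1}. *)
Section RieszBasis.
Context {R : realType} {V : lmodType R} (nrm : V -> R).
Implicit Types (phi : nat -> V) (a : nat -> R) (s : V).

Definition lincomb phi a (n : nat) : V := \sum_(j < n) a j *: phi j.

Definition has_sum phi a s : Prop :=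
  nrm (s - lincomb phi a n) @[n --> \oo] --> (0 : R).

Definition square_summable a : Prop := cvgn (series (fun j => a j ^+ 2)).

Definition sum_sqr a : R := limn (series (fun j => a j ^+ 2)).

Definition riesz_bounds phi (A B : R) : Prop :=
  forall a, square_summable a ->
    (exists s, has_sum phi a s) /\
    (forall s, has_sum phi a s ->
       A * sum_sqr a <= nrm s ^+ 2 /\ nrm s ^+ 2 <= B * sum_sqr a).

Definition span_dense phi : Prop :=
  forall (f : V) (e : R), 0 < e -> exists n a, nrm (f - lincomb phi a n) < e.

Definition riesz_basis phi (A B : R) : Prop :=
  [/\ 0 < A, A <= B, riesz_bounds phi A B & span_dense phi].

End RieszBasis.

Section L2.
Context (R : realType).

Lemma lebesgue_measure_unit_lty :
  (@lebesgue_measure R `]0%R, 1%R[%classic < +oo)%E.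
Proof. by rewrite lebesgue_measure_itv /= lte_fin ltr01 -EFinD ltry. Qed.

Definition mu01 : {finite_measure set (measurableTypeR R) -> \bar R} :=
  mfrestr (T := measurableTypeR R)
    (measurable_itv `]0%R, 1%R[) lebesgue_measure_unit_lty.

(* The values of an element outside (0,1) are irrelevant, and functions that
   agree almost everywhere on (0,1) are at [L2norm]-distance 0 but are not
   identified. *)
Definition L2 := LfunType mu01 (lee1n 2).

Definition L2norm (f : L2) : R := fine ('N[mu01]_2[EFin \o f])%E.

End L2.

Section Sawtooth.
Context {R : realType}.

Definition saw01 (t : R) : R := if t <= 2^-1 then 2 * t else 2 * (1 - t).

Definition saw (t : R) : R :=
  (-1) ^ Num.floor t * saw01 (t - (Num.floor t)%:~R).

Lemma saw01_measurable : measurable_fun [set: R] saw01.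
Proof.
apply: measurable_fun_ifT => //.
- exact: measurable_fun_ler.
- by apply: measurable_funM => //; apply: measurable_funB.
Qed.

Lemma saw_measurable : measurable_fun [set: R] saw.
Proof.
pose E (n : nat) : set R :=
  if unpickle n is Some k then `[k%:~R, (k + 1)%:~R[%classic else set0.
have mE n : measurable (E n) by rewrite /E; case: unpickle.
have -> : [set: R] = \bigcup_n E n.
  apply/esym; rewrite -subTset => t _; exists (pickle (Num.floor t)) => //.
  by rewrite /E pickleK /= in_itv /= floor_itv.
apply/measurable_fun_bigcup => // n; rewrite /E.
case: unpickle => [k|]; last exact: measurable_fun_set0.
pose g (t : R) : R := (-1) ^ (k : int) * saw01 (t - (k : int)%:~R).
apply: (eq_measurable_fun g) => [t|].
  by rewrite inE /= in_itv /= /saw => /floor_def ->.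
apply: measurable_funM => //; apply: measurable_funS (_ : measurable_fun setT _) => //.
by apply: measurableT_comp; [exact: saw01_measurable|apply: measurable_funB].
Qed.

Lemma saw_le1 (t : R) : `|saw t| <= 1.
Proof.
have /andP[l u] := floor_itv t.
have s1 (k : int) : `|(-1 : R) ^ k| = 1.
  by case: k => n; rewrite /exprz /= ?normfV normrX normrN1 expr1n ?invr1.
rewrite /saw normrM s1 mul1r /saw01.
set x := t - _; have x0 : 0 <= x by rewrite subr_ge0.
have x1 : x < 1 by rewrite ltrBlDl -{2}[1]/(1%:~R) -intrD.
by rewrite ler_norml; case: (leP x 2^-1) => h; apply/andP; split; lra.
Qed.

Definition saw_dil (j : nat) (t : R) : R := saw (j%:R * t).

Lemma saw_dil_Lfun (j : nat) :
  (saw_dil j : measurableTypeR R -> R) \in Lfun (mu01 R) 2.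
Proof.
have mf : measurable_fun [set: measurableTypeR R] (saw_dil j).
  by apply: measurableT_comp; [exact: saw_measurable|apply: measurable_funM].
apply/andP; split; rewrite inE//=.
rewrite /finite_norm unlock poweR_lty//.
apply: (@le_lt_trans _ _ (\int[mu01 R]_x (1 `^ 2)%:E)%E).
  apply: ge0_le_integral => //.
  - by move=> x _; exact: poweR_ge0.
  - apply/measurable_EFinP.
    apply: (@measurableT_comp _ _ _ _ _ _ (fun x : R => x `^ 2)) => //.
    exact: measurableT_comp.
  - by move=> x _ /=; rewrite lee_fin ge0_ler_powR ?nnegrE// saw_le1.
rewrite integral_cst// lte_mul_pinfty// ?lee_fin ?powR_ge0//.
exact: fin_num_fun_lty.
Qed.

(* S_j, where S_j(t) = S(jt), as an element of L_2(0,1) *)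
Definition sawL2 (j : nat) : L2 R := Lfun_Sub (lee1n 2) (saw_dil_Lfun j).

End Sawtooth.

(* Main.v *)
Require Import Defs.
From mathcomp Require Import all_boot all_order all_algebra.
From mathcomp Require Import all_classical all_reals all_analysis.
From mathcomp Require Import measurable_realfun ring lra.
Set Implicit Arguments.
Unset Strict Implicit.
Unset Printing Implicit Defensive.
Import Order.TTheory GRing.Theory Num.Theory.
Import numFieldNormedType.Exports.
Local Open Scope classical_set_scope.
Local Open Scope ring_scope.

(* With [e_n(t) = sqrt 2 sin(n pi t)] and [c = 4 sqrt 6 / pi^2], the Fourier
   series of the triangle wave reads
     [sqrt 3 S_j = c * sum_i (-1)^i / (2i+1)^2 e_((2i+1)j)].
   For fixed [i] the system [(e_((2i+1)j))_j] is orthonormal, so the operator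
   [e_j |-> sqrt 3 S_j] is [c] times a sum of isometries with weights
   [1/(2i+1)^2].  The weights add up to [pi^2/8], and the weight of the identity
   is [1]: the triangle inequality gives the bounds [c pi^2/8] and
   [c (2 - pi^2/8)] on norms, i.e. [sqrt B] and [sqrt A].  Since
   [pi^2/8 - 1 < 1], the [e_n] lie in the closed span of the [S_j].  The [e_n]
   are total because Bessel's inequality is an equality for the indicators of
   [(0,a)].  Both this and the Fourier series of the triangle wave come from
   [sum_n cos(n x)/n^2 = pi^2/6 - pi x/2 + x^2/4] on [[0, 2 pi]]. *)

(** * Derivatives and numerical bounds on pi *)

(** The operator itself is never formed. Estimates are made for finite combinations of truncated
    expansions, where the sums over [j] and [i] can be exchanged, and then passed to the limit in
    the truncation; square-summable coefficients come last, through completeness of L2. The constant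
    [c] comes from [S(t) = (8/pi^2) sum_i (-1)^i sin((2i+1) pi t)/(2i+1)^2]: the normalisations sqrt
    3 of [S_j] and sqrt 2 of [e_n] turn 8/pi^2 into 8 sqrt(3/2)/pi^2. Then [c pi^2/8 = sqrt 6/2],
    whose square is 3/2. Elements of L2 are functions on all of R under a seminorm that sees only
    (0,1). Hence the rays []-oo, a[], which generate the Borel sets, can stand for the intervals
    (0,a). The cosine series is differentiated term by term down to the Dirichlet kernel. The
    resulting estimates degenerate at 0, so the value there has to be recovered from the value at pi
    by an algebraic relation between partial sums. *)

Section deriv.
Context {R : realType}.
Implicit Types (x y k : R).

Lemma is_derive_mull k x : is_derive x 1 (fun y => k * y) k.
Proof.
have h := @is_deriveZ R R R id k x 1 1 (is_derive_id x 1).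
by refine (is_derive_eq h _); rewrite /GRing.scale /= mulr1.
Qed.

Lemma is_derive_monomial k n x :
  is_derive x 1 (fun y => k * y ^+ n.+1) (k * n.+1%:R * x ^+ n).
Proof.
have h := is_deriveZ k (is_deriveX n.+1 (@is_derive_id R R x 1)).
rewrite (_ : (fun y => _) = k \*: id ^+ n.+1); last first.
  by apply/funext => y; rewrite exprfctE.
by refine (is_derive_eq h _); rewrite /GRing.scale /= mulr1 mulrA.
Qed.

Lemma is_derive_sinM k x : is_derive x 1 (fun y => sin (k * y)) (k * cos (k * x)).
Proof.
rewrite mulrC; apply: (@is_derive1_comp R sin (fun y => k * y)).
exact: is_derive_mull.
Qed.

Lemma is_derive_cosM k x : is_derive x 1 (fun y => cos (k * y)) (- (k * sin (k * x))).
Proof.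
rewrite mulrC -mulNr; apply: (@is_derive1_comp R cos (fun y => k * y)).
exact: is_derive_mull.
Qed.

Lemma is_derive_sumr (N : nat) (f df : nat -> R -> R) x :
  (forall i, is_derive x 1 (f i) (df i x)) ->
  is_derive x 1 (fun y => \sum_(i < N) f i y) (\sum_(i < N) df i x).
Proof.
move=> h; rewrite (_ : (fun y => _) = \sum_(i < N) f i); first exact: is_derive_sum.
by apply/funext => y; rewrite fct_sumE.
Qed.

Lemma dist_le_derive_bound (f df : R -> R) (a b M : R) : a <= b ->
  (forall x, x \in `[a, b] -> is_derive x 1 f (df x)) ->
  (forall x, x \in `[a, b] -> `|df x| <= M) -> `|f b - f a| <= M * (b - a).
Proof.
move=> ab fdf dfM.
have fdf' x : x \in `]a, b[ -> is_derive x 1 f (df x).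
  by move=> xab; exact: fdf (subset_itv_oo_cc xab).
have cf : {within `[a, b], continuous f}.
  by apply: derivable_within_continuous => x /fdf[].
have [c cab ->] := MVT_segment ab fdf' cf.
by rewrite normrM (ger0_norm (_ : 0 <= b - a)) ?subr_ge0// ler_wpM2r ?subr_ge0// dfM.
Qed.

Lemma ge0_derive_ge0 (f df : R -> R) (b : R) : 0 <= b -> f 0 = 0 ->
  (forall x, is_derive x 1 f (df x)) ->
  (forall x, 0 <= x -> 0 <= df x) -> 0 <= f b.
Proof.
move=> b0 f0 fdf df0.
have cf : {within `[0, b], continuous f}.
  by apply: derivable_within_continuous => x _; have [] := fdf x.
have [c cab] := MVT_segment b0 (fun x _ => fdf x) cf.
rewrite f0 !subr0 => ->; rewrite mulr_ge0 ?df0//.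
by move: cab; rewrite in_itv /= => /andP[].
Qed.
End deriv.


(** * Alternating Taylor bounds and rational bounds on pi *)

Section taylor.
Context {R : realType}.
Implicit Types (x : R).

Definition sin_poly n x : R :=
  \sum_(i < n) (-1) ^+ i / ((2 * i).+1)`!%:R * x ^+ (2 * i).+1.

(** The constant term stands apart, so [cos_poly n] has [n + 1] terms against the [n] of
    [sin_poly n]. With this count [sin_poly n.+1] differentiates to [cos_poly n], and [cos_poly n]
    to [- sin_poly n]. *)
Definition cos_poly n x : R :=
  1 + \sum_(i < n) (-1) ^+ i.+1 / ((2 * i).+2)`!%:R * x ^+ (2 * i).+2.

Lemma is_derive_sin_poly n x : is_derive x 1 (sin_poly n.+1) (cos_poly n x).
Proof.
have h := @is_derive_sumr R n.+1
   (fun i x => (-1) ^+ i / ((2 * i).+1)`!%:R * x ^+ (2 * i).+1)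
   (fun i x => (-1) ^+ i / ((2 * i).+1)`!%:R * (2 * i).+1%:R * x ^+ (2 * i)) x
   (fun i => @is_derive_monomial _ _ _ _).
refine (is_derive_eq h _); rewrite /cos_poly big_ord_recl /= muln0 !mulr1.
congr (_ + _); first by rewrite !expr0 divr1.
apply: eq_bigr => i _; rewrite /bump /= add1n mulnS add2n.
congr (_ * _); rewrite -mulrA; congr (_ * _).
have n0 : (2 * i).+3%:R != 0 :> R by rewrite pnatr_eq0.
have f0 : ((2 * i).+2)`!%:R != 0 :> R by rewrite pnatr_eq0 -lt0n fact_gt0.
by rewrite (factS (2 * i).+2) natrM invfM mulrC mulrA divff// mul1r.
Qed.

Lemma is_derive_cos_poly n x : is_derive x 1 (cos_poly n) (- sin_poly n x).
Proof.
have h := is_deriveD (is_derive_cst (1 : R) (x : R) 1) (@is_derive_sumr R n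
   (fun i x => (-1) ^+ i.+1 / ((2 * i).+2)`!%:R * x ^+ (2 * i).+2)
   (fun i x => (-1) ^+ i.+1 / ((2 * i).+2)`!%:R * (2 * i).+2%:R * x ^+ (2 * i).+1) x
   (fun i => @is_derive_monomial _ _ _ _)).
refine (is_derive_eq h _); rewrite add0r /sin_poly -sumrN.
apply: eq_bigr => i _; rewrite exprS mulN1r !mulNr; congr (- (_ * _)).
rewrite -mulrA; congr (_ * _).
have n0 : (2 * i).+2%:R != 0 :> R by rewrite pnatr_eq0.
have f0 : ((2 * i).+1)`!%:R != 0 :> R by rewrite pnatr_eq0 -lt0n fact_gt0.
by rewrite (factS (2 * i).+1) natrM invfM mulrC mulrA divff// mul1r.
Qed.

(** Every remainder vanishes at 0 and has, up to sign, the preceding remainder as derivative, so its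
    sign on the half-line follows by monotonicity. The chain alternates cosine, sine, cosine and
    starts from [cos x <= 1]. *)
Lemma sin_cos_taylor n :
  (forall x, 0 <= x -> 0 <= (-1) ^+ n * (cos_poly n x - cos x)) /\
  (forall x, 0 <= x -> 0 <= (-1) ^+ n * (sin_poly n.+1 x - sin x)).
Proof.
have cs m : (forall x, 0 <= x -> 0 <= (-1) ^+ m * (cos_poly m x - cos x)) ->
   forall x, 0 <= x -> 0 <= (-1) ^+ m * (sin_poly m.+1 x - sin x).
  move=> h x x0.
  apply: (@ge0_derive_ge0 R (fun x => (-1) ^+ m * (sin_poly m.+1 x - sin x)) _ x x0 _ _ h).
    rewrite sin0 /sin_poly big1 ?subrr ?mulr0// => i _.
    by rewrite expr0n mulr0.
  move=> y; exact: (is_deriveZ _ (is_deriveB (is_derive_sin_poly m y) (is_derive_sin y))).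
elim: n => [|n [IHc IHs]].
  split; [|apply: cs] => x x0; rewrite expr0 mul1r /cos_poly big_ord0 addr0;
    by rewrite subr_ge0 cos_le1.
split; [|apply: cs] => x x0.
all: apply: (@ge0_derive_ge0 R
  (fun x => (-1) ^+ n.+1 * (cos_poly n.+1 x - cos x)) _ x x0 _ _ IHs).
all: try by rewrite cos0 /cos_poly big1 ?addr0 ?subrr ?mulr0// => i _;
    rewrite expr0n mulr0.
all: move=> y; have h := (is_deriveZ ((-1) ^+ n.+1)
    (is_deriveB (is_derive_cos_poly n.+1 y) (is_derive_cos y))).
all: by refine (is_derive_eq h _); rewrite /GRing.scale /= exprS; ring.
Qed.

Lemma sin_pi6 : sin (pi / 6) = 2^-1 :> R.
Proof.
set y : R := pi / 6; have y0 : 0 < sin y.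
  by apply: sin_gt0_pihalf; have := @pi_gt0 R; rewrite /y; lra.
have : sin (y + (y + y)) = 1.
  by rewrite (_ : _ + _ = pi / 2) ?sin_pihalf// /y; lra.
rewrite sinD sinD cosD; have := cos2Dsin2 y.
move: y0; set s := sin y; set c := cos y => s0 c1 e.
have c2 : c ^+ 2 = 1 - s ^+ 2 by lra.
(* The triple-angle equation [3 s - 4 s^3 = 1] has the double root 1/2 and the root -1, which
   [0 < s] excludes. *)
have : (s + 1) * (2 * s - 1) ^+ 2 = 0.
  have -> : (s + 1) * (2 * s - 1) ^+ 2 = 1 - (3 * s * (1 - s ^+ 2) - s ^+ 3) by ring.
  by rewrite -c2 -{1}e; ring.
move/eqP; rewrite mulf_eq0 sqrf_eq0 => /orP[]/eqP; lra.
Qed.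

Lemma sin_poly3 x : sin_poly 3 x = x - x ^+ 3 / 6 + x ^+ 5 / 120.
Proof.
rewrite /sin_poly !big_ord_recr big_ord0 /=.
rewrite (_ : (2 * 0).+1 = 1)%N// (_ : (2 * 1).+1 = 3)%N// (_ : (2 * 2).+1 = 5)%N//.
by rewrite (_ : 1`! = 1)%N// (_ : 3`! = 6)%N// (_ : 5`! = 120)%N//; field.
Qed.

Lemma sin_poly4 x : sin_poly 4 x = x - x ^+ 3 / 6 + x ^+ 5 / 120 - x ^+ 7 / (42 * 120).
Proof.
rewrite -sin_poly3 /sin_poly (big_ord_recr 3) /=; congr (_ + _).
rewrite (_ : (2 * 3).+1 = 7)%N// (_ : 7`! = (7 * 6 * 120))%N//.
by rewrite !natrM; field.
Qed.

Lemma pi_gt_1043_332 : 1043 / 332 < pi :> R.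
Proof.
rewrite ltNge; apply/negP => h.
(* [t] is a sixth of 1043/332. Were pi at most 1043/332, then [1/2 = sin (pi/6) <= sin t], whereas
   the degree-5 Taylor polynomial, an upper bound of [sin t], is already below 1/2. *)
pose t : R := 1043 / 1992.
have := (sin_cos_taylor 2).2 t; rewrite expr2 mulrNN !mul1r subr_ge0.
have ps : sin (pi / 6) <= sin t.
  have := @pi_ge2 R => p2.
  have pt : pi / 6 <= t by rewrite /t; lra.
  by case: (ltrgtP (pi/6) t) pt => // [lt _|->//]; apply: ltW;
    rewrite ltr_sin// in_itv /=; rewrite /t; lra.
have t0 : 0 <= t by rewrite /t; lra.
move=> /(_ t0) /(le_trans ps); rewrite sin_pi6 sin_poly3 /t.
lra.
Qed.

Lemma pi_lt_355_113 : pi < 355 / 113 :> R.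
Proof.
rewrite ltNge; apply/negP => h.
(* The mirror argument uses the degree-7 polynomial, a lower bound of sine; the higher degree
   matches the closeness of 355/113 to pi. *)
pose t : R := 355 / 678.
have := (sin_cos_taylor 3).2 t; rewrite -signr_odd /= expr1 mulN1r oppr_ge0 subr_le0.
have ps : sin t <= sin (pi / 6).
  have := @pi_ge2 R => p2.
  have pt : t <= pi / 6 by rewrite /t; lra.
  by case: (ltrgtP t (pi/6)) pt => // [lt _|->//]; apply: ltW;
    rewrite ltr_sin// in_itv /=; rewrite /t; lra.
have t0 : 0 <= t by rewrite /t; lra.
move=> /(_ t0) /le_trans /(_ ps); rewrite sin_pi6 sin_poly4 /t.
lra.
Qed.

End taylor.

Lemma riesz_const_bounds {R : realType} :
  (5787 / 10 ^+ 4 : R) <= (4 * Num.sqrt 6 / pi ^+ 2 * (2 - pi ^+ 2 / 8)) ^+ 2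
    < (5788 / 10 ^+ 4 : R).
Proof.
have p1 := @pi_gt_1043_332 R; have p2 := @pi_lt_355_113 R; have p0 := @pi_gt0 R.
set q : R := pi ^+ 2.
have q0 : 0 < q by rewrite exprn_gt0.
have sq (a b : R) : 0 <= a -> a <= b -> a ^+ 2 <= b ^+ 2.
  by move=> a0 ab; rewrite lerXn2r ?nnegrE// (le_trans a0).
have ql : (1043 / 332) ^+ 2 <= q by apply: sq; lra.
have qu : q <= (355 / 113) ^+ 2 by apply: sq; lra.
(* Squaring removes the root. The quotient [(16 - q) / (8 * q)] decreases in [q], and 108/1391 and
   33/425 bracket it tightly enough for four decimals of the square. *)
have -> : (4 * Num.sqrt 6 / q * (2 - q / 8)) ^+ 2 = 96 * ((16 - q) / (8 * q)) ^+ 2 :> R.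
  have -> : 4 * Num.sqrt 6 / q * (2 - q / 8) = Num.sqrt 6 * (4 * ((16 - q) / (8 * q))) :> R.
    by field; rewrite gt_eqF.
  by rewrite !exprMn sqr_sqrtr ?ler0n//; ring.
have q8 : 0 < 8 * q by lra.
have l : 108 / 1391 <= (16 - q) / (8 * q).
  rewrite ler_pdivlMr; last exact: q8.
  lra.
have u : (16 - q) / (8 * q) <= 33 / 425.
  rewrite ler_pdivrMr; last exact: q8.
  lra.
have e1 : 5787 = 57 * 100 + 87 :> R by rewrite -natrM -natrD.
have e2 : 5788 = 57 * 100 + 88 :> R by rewrite -natrM -natrD.
set x := _ / (8 * q) in l u *.
have l2 : (108 / 1391) ^+ 2 <= x ^+ 2 by apply: sq; lra.
have u2 : x ^+ 2 <= (33 / 425) ^+ 2 by apply: sq; lra.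
by rewrite e1 e2; apply/andP; split; lra.
Qed.

(** * The series of cos(nx)/n^2 *)

Section dirichlet.
Context {R : realType}.
Implicit Types (x y : R) (N : nat).

Definition dirichlet_sum N x : R := 2^-1 + \sum_(i < N) cos (i.+1%:R * x).

Lemma dirichlet_sumE N x :
  2 * sin (2^-1 * x) * dirichlet_sum N x = sin ((N%:R + 2^-1) * x).
Proof.
rewrite /dirichlet_sum; elim: N => [|N IH]; first by rewrite big_ord0 addr0 add0r; field.
rewrite big_ord_recr /= addrA mulrDr IH.
have -> : (N%:R + 2^-1) * x = N.+1%:R * x - 2^-1 * x by rewrite -natr1; field.
have -> : (N.+1%:R + 2^-1) * x = N.+1%:R * x + 2^-1 * x by rewrite -natr1; field.
by rewrite sinB sinD; ring.
Qed.

(** Error of the partial sums of [sum_n sin(n x)/n] against their limit [(pi - x)/2] on (0, 2 pi).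
    Subtracting the limit supplies the constant 1/2 of the Dirichlet sum on differentiation. *)
Definition sawtooth_sum N x : R :=
  \sum_(i < N) i.+1%:R^-1 * sin (i.+1%:R * x) - 2^-1 * (pi - x).

Lemma is_derive_sawtooth_sum N x :
  is_derive x 1 (sawtooth_sum N) (dirichlet_sum N x).
Proof.
have h1 := @is_derive_sumr R N (fun i x => i.+1%:R^-1 * sin (i.+1%:R * x))
  (fun i x => i.+1%:R^-1 * (i.+1%:R * cos (i.+1%:R * x))) x
  (fun i => is_deriveZ _ (is_derive_sinM _ _)).
have h2 := is_deriveZ (2^-1 : R)
  (is_deriveB (is_derive_cst (pi : R) x 1) (@is_derive_id R R x 1)).
refine (is_derive_eq (is_deriveB h1 h2) _).
rewrite /dirichlet_sum /GRing.scale /= sub0r mulrN1 opprK addrC; congr (_ + _).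
by apply: eq_bigr => i _; rewrite mulKf// pnatr_eq0.
Qed.

Lemma sin_natpi n : sin (n%:R * pi) = 0 :> R.
Proof.
have := alternatingn (@sinDpi R) n 0.
by rewrite add0r sin0 mulr0 mulr_natl.
Qed.

Lemma cos_natpi n : cos (n%:R * pi) = (-1) ^+ n :> R.
Proof.
have := alternatingn (@cosDpi R) n 0.
by rewrite add0r cos0 mulr1 mulr_natl.
Qed.

Lemma sawtooth_sum_pi N : sawtooth_sum N pi = 0.
Proof.
rewrite /sawtooth_sum subrr mulr0 subr0 big1// => i _.
by rewrite sin_natpi mulr0.
Qed.

Lemma le_sin_half x y : 0 <= x -> x <= y -> y <= pi -> sin (2^-1 * x) <= sin (2^-1 * y).
Proof.
move=> x0 xy ypi; have := @pi_gt0 R => p0.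
case: (ltrgtP x y) xy => // [xy _|-> //].
by apply: ltW; rewrite ltr_sin ?in_itv /=; lra.
Qed.

(* Integration by parts: adding the corrector [g] cancels the oscillating
   Dirichlet kernel in the derivative and leaves a term of size [O(1/N)]. *)
Lemma sawtooth_sum_le N x : 0 < x -> x <= pi ->
  `|sawtooth_sum N x| <= 2 / ((N%:R + 2^-1) * sin (2^-1 * x) ^+ 2).
Proof.
move=> x0 xpi; have p0 := @pi_gt0 R.
have s0 : 0 < sin (2^-1 * x) by apply: sin_gt0_pi; lra.
set m : R := N%:R + 2^-1; set s := sin (2^-1 * x) in s0 *.
have m0 : 0 < m by rewrite ltr_wpDl// invr_gt0.
have s1 : s <= 1 by exact: sin_le1.
have spos y : x <= y -> y <= pi -> s <= sin (2^-1 * y).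
  by move=> xy yp; apply: le_sin_half => //; exact: ltW.
pose g y : R := (2 * m)^-1 * (cos (m * y) * (sin (2^-1 * y))^-1).
pose dg y : R := - ((4 * m)^-1 * (cos (m * y) * cos (2^-1 * y) * (sin (2^-1 * y)) ^- 2)).
have dgP y : y \in `[x, pi] -> is_derive y 1 (fun y => sawtooth_sum N y + g y) (dg y).
  rewrite in_itv /= => /andP[xy yp].
  have sy0 : sin (2^-1 * y) != 0 by rewrite gt_eqF// (lt_le_trans s0)// spos.
  have h1 := is_derive_sawtooth_sum N y.
  have h2 := is_deriveZ ((2 * m)^-1) (is_deriveM (is_derive_cosM m y)
     (is_deriveV sy0 (is_derive_sinM (2^-1) y))).
  refine (is_derive_eq (is_deriveD h1 h2) _).
  have -> : dirichlet_sum N y = sin (m * y) / (2 * sin (2^-1 * y)).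
    by rewrite -dirichlet_sumE mulrAC divff ?mul1r// mulf_neq0.
  by rewrite /GRing.scale /= /dg; field; rewrite sy0 gt_eqF.
have dgM y : y \in `[x, pi] -> `|dg y| <= (4 * m * s ^+ 2)^-1.
  rewrite in_itv /= => /andP[xy yp].
  have sy := spos y xy yp; have sy0 := lt_le_trans s0 sy.
  rewrite /dg normrN normrM gtr0_norm ?invr_gt0 ?mulr_gt0// (invfM (4 * m)).
  rewrite ler_pM2l ?invr_gt0 ?mulr_gt0// normrM.
  rewrite -[leRHS]mul1r ler_pM//.
    by rewrite normrM mulr_ile1// cos_max.
  by rewrite gtr0_norm ?invr_gt0 ?exprn_gt0// lef_pV2 ?posrE ?exprn_gt0//;
    apply: lerXn2r => //; rewrite nnegrE ltW.
have := dist_le_derive_bound xpi dgP dgM.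
have -> : g pi = 0.
  rewrite /g; have -> : cos (m * pi) = 0.
    by rewrite /m (mulrDl _ _ pi) [2^-1 * pi]mulrC cosDpihalf sin_natpi oppr0.
  by rewrite mul0r mulr0.
rewrite sawtooth_sum_pi addr0 sub0r normrN => h.
have gle : `|g x| <= (2 * m * s ^+ 2)^-1.
  rewrite /g normrM gtr0_norm ?invr_gt0 ?mulr_gt0// (invfM (2 * m)) ler_pM2l ?invr_gt0 ?mulr_gt0//.
  rewrite normrM -/s -[leRHS]mul1r ler_pM ?cos_max// gtr0_norm ?invr_gt0//.
  by rewrite lef_pV2 ?posrE ?exprn_gt0// expr2 ler_piMr// ltW.
have : `|sawtooth_sum N x| <= `|sawtooth_sum N x + g x| + `|g x|.
  by rewrite -{1}[sawtooth_sum N x](addrK (g x)) ler_normB.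
(* With [k = 1/(m s^2)] the two contributions are [k (pi - x)/4] and [k/2]; this crude bound keeps
   their sum below [2 k]. *)
have pi4 : pi - x <= 4 by have := @pi_lt_355_113 R; lra.
have k0 : 0 < (m * s ^+ 2)^-1 by rewrite invr_gt0 mulr_gt0// exprn_gt0.
rewrite -[4 * m * _]mulrA (invfM 4) in h; rewrite -[2 * m * _]mulrA (invfM 2) in gle.
move: h gle; set k := (m * s ^+ 2)^-1 in k0 * => h gle; nra.
Qed.

Definition cosine_sum N x : R := \sum_(i < N) i.+1%:R ^- 2 * cos (i.+1%:R * x).

(** Its derivative is [-(pi - x)/2], so [cosine_sum N - cosine_lim] differentiates to
    [- sawtooth_sum N]. The constant term [pi^2/6] is justified only in [cvg_cosine_sum_pi]. *)
Definition cosine_lim x : R := pi ^+ 2 / 6 - 2^-1 * pi * x + 4^-1 * x ^+ 2.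

(** The bound of [sawtooth_sum_le] is used on all of [[x, pi]], where it is largest at the left end
    because [sin (y/2)] increases up to pi. The error is thus constant up to O(1/N), but not
    uniformly near 0. *)
Lemma cosine_sum_dist N x : 0 < x -> x <= pi ->
  `|(cosine_sum N pi - cosine_lim pi) - (cosine_sum N x - cosine_lim x)|
    <= 8 / ((N%:R + 2^-1) * sin (2^-1 * x) ^+ 2).
Proof.
move=> x0 xpi; have p0 := @pi_gt0 R.
have s0 : 0 < sin (2^-1 * x) by apply: sin_gt0_pi; lra.
have m0 : 0 < N%:R + 2^-1 :> R by rewrite ltr_wpDl// invr_gt0.
have dP y : y \in `[x, pi] ->
    is_derive y 1 (fun y => cosine_sum N y - cosine_lim y) (- sawtooth_sum N y).
  move=> _.
  have h1 := @is_derive_sumr R N (fun i x => i.+1%:R ^- 2 * cos (i.+1%:R * x))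
    (fun i x => i.+1%:R ^- 2 * (- (i.+1%:R * sin (i.+1%:R * x)))) y
    (fun i => is_deriveZ _ (is_derive_cosM _ _)).
  have h2 := is_deriveD (is_deriveB (is_derive_cst (pi ^+ 2 / 6 : R) y 1)
     (is_derive_mull (2^-1 * pi : R) y)) (is_derive_monomial 4^-1 1 y).
  refine (is_derive_eq (is_deriveB h1 h2) _).
  rewrite /sawtooth_sum opprB addrC; congr (_ + _); first by field.
  rewrite -sumrN; apply: eq_bigr => i _.
  have k0 : i.+1%:R != 0 :> R by rewrite pnatr_eq0.
  by move: (i.+1%:R : R) k0 => k k0; field.
have dM y : y \in `[x, pi] ->
    `|- sawtooth_sum N y| <= 2 / ((N%:R + 2^-1) * sin (2^-1 * x) ^+ 2).
  rewrite in_itv /= => /andP[xy yp]; rewrite normrN.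
  have sy := le_sin_half (ltW x0) xy yp; have sy0 := lt_le_trans s0 sy.
  apply: (le_trans (sawtooth_sum_le N (lt_le_trans x0 xy) yp)).
  rewrite ler_pM2l// lef_pV2 ?posrE ?mulr_gt0 ?exprn_gt0// ler_pM2l//.
  by apply: lerXn2r => //; rewrite nnegrE ltW.
have := dist_le_derive_bound xpi dP dM => /le_trans; apply.
have pi4 : pi - x <= 4 by have := @pi_lt_355_113 R; lra.
have k0 : 0 < ((N%:R + 2^-1) * sin (2^-1 * x) ^+ 2)^-1 by rewrite invr_gt0 mulr_gt0// exprn_gt0.
move: k0; set k := _^-1; nra.
Qed.

End dirichlet.

(** * Closed form of the cosine series *)

Section cosine_series.
Context {R : realType}.
Implicit Types (x t u : R) (N : nat).

Lemma sum_even_odd (f : nat -> R) N :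
  \sum_(i < 2 * N) f i.+1 = \sum_(i < N) f (2 * i).+1 + \sum_(i < N) f (2 * i).+2.
Proof.
elim: N => [|N IH]; first by rewrite !big_ord0 addr0.
by rewrite mulnS add2n !big_ord_recr /= IH; ring.
Qed.

(** At pi/2 the odd indices contribute zero cosines, and the even ones repeat the terms at pi with a
    factor 1/4. This relation fixes the constant of integration. *)
Lemma cosine_sum_half N : cosine_sum (2 * N) (pi / 2) = 4^-1 * cosine_sum N pi :> R.
Proof.
rewrite /cosine_sum (sum_even_odd (fun k => k%:R ^- 2 * cos (k%:R * (pi / 2)))).
rewrite big1 ?add0r => [|i _]; last first.
  have -> : (2 * i).+1%:R * (pi / 2) = i%:R * pi + pi / 2 :> R.
    by rewrite -natr1 natrM; field.
  by rewrite cosDpihalf sin_natpi oppr0 mulr0.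
rewrite mulr_sumr; apply: eq_bigr => i _.
have -> : (2 * i).+2%:R = 2 * i.+1%:R :> R by rewrite -natrM mulnS add2n.
have -> : 2 * i.+1%:R * (pi / 2) = i.+1%:R * pi :> R by field.
have : i.+1%:R != 0 :> R by rewrite pnatr_eq0.
by move: (i.+1%:R : R) => k k0; field.
Qed.

(** As [cos(n pi) = (-1)^n], odd terms cancel and even ones double. This reaches the value at 0,
    where the error estimate breaks down. *)
Lemma cosine_sum_double N :
  cosine_sum (2 * N) 0 + cosine_sum (2 * N) pi = 2^-1 * cosine_sum N 0 :> R.
Proof.
rewrite /cosine_sum -big_split /=.
rewrite (sum_even_odd (fun k => k%:R ^- 2 * cos (k%:R * 0) + k%:R ^- 2 * cos (k%:R * pi))).
rewrite big1 ?add0r => [|i _]; last first.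
  rewrite mulr0 cos0 cos_natpi -signr_odd /= oddM /=.
  by rewrite expr1 mulrN subrr.
rewrite mulr_sumr; apply: eq_bigr => i _.
rewrite !mulr0 cos0 cos_natpi -signr_odd /= oddM /= expr0.
have -> : (2 * i).+2%:R = 2 * i.+1%:R :> R by rewrite -natrM mulnS add2n.
have : i.+1%:R != 0 :> R by rewrite pnatr_eq0.
by move: (i.+1%:R : R) => k k0; field.
Qed.

Lemma cosine_sum_refl N x : cosine_sum N (2 * pi - x) = cosine_sum N x.
Proof.
apply: eq_bigr => i _; congr (_ * _).
rewrite mulrBr -cosN opprB.
have := periodicn (@cosD2pi R) i.+1 (i.+1%:R * x - i.+1%:R * (2 * pi)).
by move=> <-; congr cos; rewrite -[X in _ + X]mulr_natl -[pi *+ 2]mulr_natl subrK.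
Qed.

Lemma cosine_lim_refl x : cosine_lim (2 * pi - x) = cosine_lim x.
Proof. by rewrite /cosine_lim; field. Qed.

Definition odd_cosine_sum N x : R :=
  \sum_(i < N) (2 * i).+1%:R ^- 2 * cos ((2 * i).+1%:R * x).

Lemma odd_cosine_sumE N x :
  odd_cosine_sum N x = cosine_sum (2 * N) x - 4^-1 * cosine_sum N (2 * x).
Proof.
rewrite /cosine_sum (sum_even_odd (fun k => k%:R ^- 2 * cos (k%:R * x))).
rewrite -addrA mulr_sumr [X in _ + X](_ : _ = 0) ?addr0//.
apply/eqP; rewrite subr_eq0; apply/eqP; apply: eq_bigr => i _.
have -> : (2 * i).+2%:R = 2 * i.+1%:R :> R by rewrite -natrM mulnS add2n.
have : i.+1%:R != 0 :> R by rewrite pnatr_eq0.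
move: (i.+1%:R : R) => k k0.
by rewrite [k * (2 * x)]mulrA [k * 2]mulrC; field.
Qed.

(** Telescoping: [1/(N+1)^2] is at most [1/(N+1/2) - 1/(N+3/2) = 1/((N+1)^2 - 1/4)]. *)
Lemma sum_inv_sqr_le N : \sum_(i < N) i.+1%:R ^- 2 <= 2 - (N%:R + 2^-1)^-1 :> R.
Proof.
elim: N => [|N IH]; first by rewrite big_ord0 add0r invrK subrr.
rewrite big_ord_recr /=; apply: (le_trans (lerD IH (lexx _))).
rewrite -(natr1 N); have : 0 <= N%:R :> R by [].
move: (N%:R : R) => n n0; rewrite -subr_ge0.
rewrite (_ : _ - _ = 4^-1 / ((n + 1) ^+ 2 * ((n + 2^-1) * (n + 1 + 2^-1)))).
  by rewrite divr_ge0// !mulr_ge0// ?exprn_ge0//; lra.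
by field; rewrite !gt_eqF//; lra.
Qed.

Lemma is_cvg_sum_inv_sqr : cvgn (series (fun i => i.+1%:R ^- 2 : R)).
Proof.
apply: nondecreasing_is_cvgn.
  by apply: nondecreasing_series => i _ _; rewrite invr_ge0 exprn_ge0.
exists 2 => _ [n _ <-]; rewrite /series /= big_mkord.
by apply: (le_trans (sum_inv_sqr_le n)); rewrite lerBlDr lerDl invr_ge0.
Qed.

Lemma is_cvg_cosine_sum x : cvgn (fun N => cosine_sum N x).
Proof.
suff : cvgn (series (fun i => i.+1%:R ^- 2 * cos (i.+1%:R * x) : R)).
  rewrite (_ : series _ = fun N => cosine_sum N x)//.
  by apply/funext => N; rewrite /series /= big_mkord.
apply: normed_cvg; apply: series_le_cvg is_cvg_sum_inv_sqr => //= i.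
by rewrite normrM ger0_norm ?invr_ge0 ?exprn_ge0// ler_piMr ?cos_max// invr_ge0 exprn_ge0.
Qed.

Lemma cvgn_unique (u : nat -> R) (l l' : R) : u @ \oo --> l -> u @ \oo --> l' -> l = l'.
Proof. by move=> /cvg_lim <- // /cvg_lim <-. Qed.

Lemma cvg_double (u : nat -> R) (l : R) : u @ \oo --> l -> (fun N => u (2 * N)%N) @ \oo --> l.
Proof.
move=> ul; apply: (cvg_comp _ _ _ ul).
apply/cvgnyPge => A; near=> n.
rewrite (@leq_trans n)//; last by rewrite leq_pmull.
by near: n; exact: nbhs_infty_ge.
Unshelve. all: by end_near. Qed.

Lemma cvg_cosine_sum_diff x : 0 < x -> x <= pi ->
  (fun N => (cosine_sum N pi - cosine_lim pi) - (cosine_sum N x - cosine_lim x)) @ \oo --> (0 : R).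
Proof.
move=> x0 xpi; apply/cvgrPdist_le => e e0.
have s0 : 0 < sin (2^-1 * x) by apply: sin_gt0_pi; have := @pi_gt0 R; lra.
have k0 : 0 < 8 / (e * sin (2^-1 * x) ^+ 2) by rewrite divr_gt0// mulr_gt0// exprn_gt0.
near=> N; rewrite sub0r normrN.
apply: (le_trans (cosine_sum_dist N x0 xpi)).
rewrite ler_pdivrMr ?mulr_gt0 ?exprn_gt0 ?ltr_wpDl//.
rewrite mulrCA -ler_pdivrMr ?mulr_gt0 ?exprn_gt0//.
apply: (@le_trans _ _ N%:R); last by rewrite lerDl invr_ge0.
by near: N; exact: nbhs_infty_ger.
Unshelve. all: by end_near. Qed.

(* [cosine_sum N - cosine_lim] tends to a constant on [(0, pi]]; as both sides
   satisfy [f (pi / 2) = f pi / 4], that constant is [0]. *)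
Lemma cvg_cosine_sum_pi : (fun N => cosine_sum N pi) @ \oo --> cosine_lim (pi : R).
Proof.
have [L cL] : exists L : R, (fun N => cosine_sum N pi) @ \oo --> L.
  by apply/cvg_ex; exact: is_cvg_cosine_sum.
have p0 := @pi_gt0 R.
have p2 : 0 < pi / 2 :> R by rewrite divr_gt0.
have p2' : pi / 2 <= pi :> R by lra.
have h := cvg_double (cvg_cosine_sum_diff p2 p2').
have h' : (fun N => (cosine_sum (2 * N) pi - cosine_lim pi) -
    (4^-1 * cosine_sum N pi - cosine_lim (pi / 2))) @ \oo -->
    ((L - cosine_lim pi) - (4^-1 * L - cosine_lim (pi / 2)) : R).
  exact: (cvgB (cvgB (cvg_double cL) (cvg_cst (cosine_lim pi)))
    (cvgB (cvgMl_tmp cL) (cvg_cst (cosine_lim (pi / 2))))).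
have e : (fun N => (cosine_sum (2 * N) pi - cosine_lim pi) -
    (4^-1 * cosine_sum N pi - cosine_lim (pi / 2))) =
    (fun N => (cosine_sum (2 * N) pi - cosine_lim pi) -
    (cosine_sum (2 * N) (pi / 2) - cosine_lim (pi / 2)) : R).
  by apply/funext => N; rewrite cosine_sum_half.
rewrite e in h'.
have E := cvgn_unique h h'.
suff <- : L = cosine_lim pi by [].
move: E; rewrite /cosine_lim; set p := pi; nra.
Qed.

Lemma cvg_cosine_sum_le_pi x : 0 <= x -> x <= pi ->
  (fun N => cosine_sum N x) @ \oo --> cosine_lim x.
Proof.
rewrite le_eqVlt => /predU1P[<- _|x0 xpi]; last first.
  rewrite (_ : (fun N => _) = fun N => cosine_sum N pi - cosine_lim pi -
      ((cosine_sum N pi - cosine_lim pi) - (cosine_sum N x - cosine_lim x)) + cosine_lim x).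
    rewrite -[X in _ --> X]add0r -{1}[0](subr0 0) -{1}(subrr (cosine_lim pi)).
    apply: cvgD; last exact: cvg_cst.
    apply: cvgB; last exact: cvg_cosine_sum_diff.
    by apply: cvgB; [exact: cvg_cosine_sum_pi|exact: cvg_cst].
  by apply/funext => N; ring.
(* At [x = 0] the limit [Z] exists by absolute convergence, and the doubling relation gives
   [Z + cosine_lim pi = Z/2], that is [Z = pi^2/6]. *)
have [Z cZ] : exists Z : R, (fun N => cosine_sum N 0) @ \oo --> Z.
  by apply/cvg_ex; exact: is_cvg_cosine_sum.
have h1 : (fun N => cosine_sum (2 * N) 0 + cosine_sum (2 * N) pi) @ \oo -->
    (Z + cosine_lim pi : R).
  exact: (cvgD (cvg_double cZ) (cvg_double cvg_cosine_sum_pi)).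
have h2 : (fun N => 2^-1 * cosine_sum N 0) @ \oo --> (2^-1 * Z : R) by exact: (cvgMl_tmp cZ).
have e : (fun N => cosine_sum (2 * N) 0 + cosine_sum (2 * N) pi)
    = (fun N => 2^-1 * cosine_sum N 0) :> (nat -> R).
  by apply/funext => N; rewrite -cosine_sum_double.
rewrite e in h1.
have E := cvgn_unique h1 h2.
suff <- : Z = cosine_lim 0 by [].
move: E; rewrite /cosine_lim; set p := pi; nra.
Qed.

(** Points beyond pi follow by reflection about pi. They are needed because both the odd-index
    series and the squared sine coefficients of an interval involve a doubled angle. *)
Lemma cvg_cosine_sum x : 0 <= x -> x <= 2 * pi ->
  (fun N => cosine_sum N x) @ \oo --> cosine_lim x.
Proof.
move=> x0 x2; have [xpi|xpi] := leP x pi; first exact: cvg_cosine_sum_le_pi.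
rewrite -cosine_lim_refl; under eq_fun do rewrite -cosine_sum_refl.
by apply: cvg_cosine_sum_le_pi; lra.
Qed.

Lemma cvg_odd_cosine_sum x : 0 <= x -> x <= pi ->
  (fun N => odd_cosine_sum N x) @ \oo --> pi ^+ 2 / 8 - pi * x / 4.
Proof.
move=> x0 xpi; have p0 := @pi_gt0 R.
under eq_fun do rewrite odd_cosine_sumE.
have -> : pi ^+ 2 / 8 - pi * x / 4 = cosine_lim x - 4^-1 * cosine_lim (2 * x).
  by rewrite /cosine_lim; field.
have h1 : (fun N => cosine_sum N x) @ \oo --> cosine_lim x.
  by apply: cvg_cosine_sum; lra.
have h2 : (fun N => cosine_sum N (2 * x)) @ \oo --> cosine_lim (2 * x).
  by apply: cvg_cosine_sum; lra.
exact: (cvgB (cvg_double h1) (cvgMl_tmp h2)).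
Qed.

End cosine_series.

(** * The Fourier series of the triangle wave *)

Section saw_series.
Context {R : realType}.
Implicit Types (x t u : R) (N : nat).

Definition saw_sum N t : R :=
  \sum_(i < N) (-1) ^+ i * (2 * i).+1%:R ^- 2 * sin ((2 * i).+1%:R * (pi * t)).

(** Shifting the argument by 1/2 turns each odd sine into a cosine and absorbs the sign [(-1)^i]. By
    evenness the absolute value can be taken, which puts the angle in [[0, pi]] when [t] is in
    [[0, 1]]. *)
Lemma saw_sumE N t : saw_sum N t = odd_cosine_sum N (pi * `|t - 2^-1|).
Proof.
apply: eq_bigr => i _.
rewrite -[X in cos (_ * (X * _))](@ger0_norm _ pi) ?pi_ge0// -normrM.
rewrite -[X in cos (X * _)](@ger0_norm _ (2 * i).+1%:R)// -normrM cos_norm.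
have -> : (2 * i).+1%:R * (pi * (t - 2^-1)) =
    (2 * i).+1%:R * (pi * t) - i%:R * pi - pi / 2 :> R.
  by rewrite -natr1 natrM; field.
by rewrite cosBpihalf sinB cos_natpi sin_natpi mulr0 subr0; ring.
Qed.

Lemma cvg_saw_sum01 t : 0 <= t -> t <= 1 ->
  (fun N => saw_sum N t) @ \oo --> pi ^+ 2 / 8 * saw01 t.
Proof.
move=> t0 t1; have p0 := @pi_gt0 R.
under eq_fun do rewrite saw_sumE.
have n1 : `|t - 2^-1| <= 1 by rewrite ler_norml; apply/andP; split; lra.
have -> : pi ^+ 2 / 8 * saw01 t = pi ^+ 2 / 8 - pi * (pi * `|t - 2^-1|) / 4.
  rewrite /saw01; have [h|h] := leP t 2^-1.
    by rewrite ler0_norm ?subr_le0//; field.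
  by rewrite ger0_norm ?subr_ge0 1?ltW//; field.
apply: cvg_odd_cosine_sum; first by rewrite mulr_ge0// ltW.
by rewrite ler_piMr// ltW.
Qed.

(** Only odd frequencies occur in [saw_sum], so its terms obey the rule [(-1)^floor] by which [saw]
    extends [saw01]; convergence on [[0, 1]] then gives it on all of R. *)
Lemma sin_addz_oddpi (k : nat) (z : int) x : odd k ->
  sin (x + k%:R * (pi * z%:~R)) = (-1) ^ z * sin x.
Proof.
move=> ok.
have h (n : nat) (y : R) : sin (y + k%:R * (pi * n%:R)) = (-1) ^+ n * sin y.
  have := alternatingn (@sinDpi R) (k * n) (y : R).
  rewrite -signr_odd oddM ok /= signr_odd => <-.
  by congr sin; rewrite -[pi *+ _]mulr_natl natrM; ring.
case: z => n; first exact: h.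
rewrite NegzE mulrNz !mulrN -pmulrn.
rewrite -[X in _ = _ * sin X](subrK (k%:R * (pi * n.+1%:R))) h.
by rewrite /exprz mulKf// signr_eq0.
Qed.

Lemma cvg_saw_sum t : (fun N => saw_sum N t) @ \oo --> pi ^+ 2 / 8 * saw t.
Proof.
have /andP[l u] := floor_itv t.
set z := Num.floor t in l u; set v := t - z%:~R.
have v0 : 0 <= v by rewrite subr_ge0.
have v1 : v <= 1 by move: u; rewrite intrD /v; lra.
have -> : pi ^+ 2 / 8 * saw t = (-1) ^ z * (pi ^+ 2 / 8 * saw01 v).
  by rewrite /saw -/z -/v mulrCA.
have -> : (fun N => saw_sum N t) = (fun N => (-1) ^ z * saw_sum N v).
  apply/funext => N; rewrite /saw_sum mulr_sumr; apply: eq_bigr => i _.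
  rewrite [RHS]mulrCA -(@sin_addz_oddpi (2 * i).+1); last by rewrite /= oddM.
  by congr (_ * sin _); rewrite /v; ring.
by apply: cvgMl_tmp; exact: cvg_saw_sum01.
Qed.

Lemma dist_lim_le (u v : nat -> R) (l w : R) N :
  (forall M, (N <= M)%N -> `|u M - u N| <= v M - v N) ->
  u @ \oo --> l -> v @ \oo --> w -> `|l - u N| <= w - v N.
Proof.
move=> h ul vw.
have h1 : (fun M => `|u M - u N|) @ \oo --> `|l - u N|.
  by apply: cvg_norm; apply: cvgB => //; exact: cvg_cst.
have h2 : (fun M => v M - v N) @ \oo --> w - v N by apply: cvgB => //; exact: cvg_cst.
apply: (ler_cvg_to h1 h2); near=> M; apply: h; near: M; exact: nbhs_infty_ge.
Unshelve. all: by end_near. Qed.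

Definition odd_inv_sqr N : R := \sum_(i < N) (2 * i).+1%:R ^- 2.

Lemma cvg_odd_inv_sqr : odd_inv_sqr @ \oo --> pi ^+ 2 / 8.
Proof.
have := @cvg_odd_cosine_sum R 0 (lexx _) (@pi_ge0 R).
rewrite mulr0 mul0r subr0 (_ : (fun N => _) = odd_inv_sqr)//.
by apply/funext => N; apply: eq_bigr => i _; rewrite mulr0 cos0 mulr1.
Qed.

(** Weierstrass test: as sines are at most 1 in absolute value, the tail of the series is dominated
    by the tail of the weights, uniformly in [t]. *)
Lemma saw_sum_dist N t :
  `|pi ^+ 2 / 8 * saw t - saw_sum N t| <= pi ^+ 2 / 8 - odd_inv_sqr N.
Proof.
have h M : (N <= M)%N ->
    `|saw_sum M t - saw_sum N t| <= odd_inv_sqr M - odd_inv_sqr N.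
  move=> NM.
  have sumB (F : nat -> R) :
      \sum_(i < M) F i - \sum_(i < N) F i = \sum_(N <= i < M) F i.
    by rewrite -!(big_mkord xpredT F) (big_cat_nat (n := N) (p := M))//= [X in X - _]addrC addrK.
  rewrite (sumB (fun i => (-1) ^+ i * (2 * i).+1%:R ^- 2 * sin ((2 * i).+1%:R * (pi * t)))).
  rewrite (sumB (fun i => (2 * i).+1%:R ^- 2)).
  apply: (le_trans (ler_norm_sum _ _ _)); apply: ler_sum => i _.
  rewrite !normrM normrX normrN1 expr1n mul1r ger0_norm ?invr_ge0 ?exprn_ge0//.
  by rewrite ler_piMr ?sin_max// invr_ge0 exprn_ge0.
exact: (dist_lim_le h (@cvg_saw_sum t) cvg_odd_inv_sqr).
Qed.
End saw_series.

(** * The space L2 *)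

Section L2_basics.
Context {R : realType}.
Local Notation mu := (mu01 R).
Local Notation T := (measurableTypeR R).
Implicit Types (f g h : L2 R) (a : R).

Lemma mu01_setT : mu [set: T] = 1%E.
Proof.
rewrite /mu01 /= /mfrestr /= /mrestr setTI.
by rewrite lebesgue_measure_itv /= lte_fin ltr01 -EFinD subr0.
Qed.

Lemma integral_cst01 a : (\int[mu]_x a%:E = a%:E)%E.
Proof. by rewrite integral_cst// -[RHS]mule1; congr (_ * _)%E; exact: mu01_setT. Qed.

Lemma bounded_Lfun2 (f : T -> R) (M : R) :
  measurable_fun [set: T] f -> (forall x, `|f x| <= M) -> f \in Lfun mu 2.
Proof.
move=> mf fM; apply/andP; split; rewrite inE//=.
rewrite /finite_norm unlock poweR_lty//.
apply: (@le_lt_trans _ _ (\int[mu]_x (M `^ 2)%:E)%E).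
  apply: ge0_le_integral => //.
  - by move=> x _; exact: poweR_ge0.
  - apply/measurable_EFinP.
    apply: (@measurableT_comp _ _ _ _ _ _ (fun x : R => x `^ 2)) => //.
    exact: measurableT_comp.
  - move=> x _ /=; rewrite lee_fin ge0_ler_powR ?nnegrE//.
    exact: le_trans (fM x).
by rewrite integral_cst01 ltry.
Qed.

Lemma L2_measurable f : measurable_fun [set: T] f.
Proof. by []. Qed.

Lemma L2addE f g x : (f + g) x = f x + g x. Proof. by []. Qed.
Lemma L2oppE f x : (- f) x = - f x. Proof. by []. Qed.
Lemma L2scaleE a f x : (a *: f) x = a * f x. Proof. by []. Qed.
Lemma L2zeroE x : (0 : L2 R) x = 0. Proof. by []. Qed.
Lemma L2sumE n (F : nat -> L2 R) x : (\sum_(i < n) F i) x = \sum_(i < n) F i x.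
Proof.
exact: (big_morph (fun f : L2 R => f x) (fun f g => L2addE f g x) (L2zeroE x)).
Qed.

Lemma L2norm_ge0 f : 0 <= L2norm f.
Proof. by rewrite fine_ge0// Lnorm_ge0. Qed.

Lemma ler_L2normD f g : L2norm (f + g) <= L2norm f + L2norm g.
Proof. exact: ler_LnormD. Qed.

Lemma L2normZ a f : L2norm (a *: f) = `|a| * L2norm f.
Proof.
apply: EFin_inj; rewrite EFinM /L2norm !finite_norm_fine.
exact: LnormZ.
Qed.

Lemma L2norm_sqrE f : (L2norm f ^+ 2)%:E = (\int[mu]_x (f x ^+ 2)%:E)%E.
Proof.
have n2 : (2 : R) != 0 by rewrite pnatr_eq0.
have h := powR_Lnorm mu (EFin \o f) n2.
rewrite -powR_mulrn ?L2norm_ge0// -poweR_EFin /L2norm finite_norm_fine.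
rewrite h; apply: eq_integral => x _ /=.
by rewrite powR_mulrn// real_normK// num_real.
Qed.

Lemma L2_integrableM f g : mu.-integrable [set: T] (EFin \o (fun x => f x * g x)).
Proof. by apply/Lfun1_integrable; apply: Lfun2_mul_Lfun1; exact: LfunP. Qed.

Definition ip f g : R := \int[mu]_x (f x * g x).

Lemma ipC f g : ip f g = ip g f.
Proof. by apply: eq_Rintegral => x _; rewrite mulrC. Qed.

Lemma ipDl f g h : ip (f + g) h = ip f h + ip g h.
Proof.
rewrite /ip -RintegralD//; try exact: L2_integrableM.
by apply: eq_Rintegral => x _; rewrite L2addE mulrDl.
Qed.

Lemma ipZl a f g : ip (a *: f) g = a * ip f g.
Proof.
rewrite /ip -RintegralZl//; last exact: L2_integrableM.
by apply: eq_Rintegral => x _; rewrite L2scaleE mulrA.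
Qed.

Lemma L2norm_sqr f : L2norm f ^+ 2 = ip f f.
Proof. by rewrite -[LHS]/(fine (_%:E)) L2norm_sqrE. Qed.

Lemma ipDr f g h : ip f (g + h) = ip f g + ip f h.
Proof. by rewrite ipC ipDl !(ipC f). Qed.

Lemma ipZr a f g : ip f (a *: g) = a * ip f g.
Proof. by rewrite ipC ipZl (ipC f). Qed.

Lemma ipNl f g : ip (- f) g = - ip f g.
Proof. by rewrite -scaleN1r ipZl mulN1r. Qed.

Lemma ipNr f g : ip f (- g) = - ip f g.
Proof. by rewrite ipC ipNl ipC. Qed.

Lemma ip0l f : ip 0 f = 0.
Proof. by rewrite -(scale0r (0 : L2 R)) ipZl mul0r. Qed.

Lemma ip_suml n (F : nat -> L2 R) g : ip (\sum_(i < n) F i) g = \sum_(i < n) ip (F i) g.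
Proof.
by elim: n => [|n IH]; rewrite ?big_ord0 ?ip0l// !big_ord_recr ipDl IH.
Qed.

Lemma ip_sumr n (F : nat -> L2 R) g : ip g (\sum_(i < n) F i) = \sum_(i < n) ip g (F i).
Proof. by rewrite ipC ip_suml; apply: eq_bigr => i _; exact: ipC. Qed.

Lemma L2norm_le_sup f (M : R) : (forall x, `|f x| <= M) -> L2norm f <= M.
Proof.
move=> fM; have M0 : 0 <= M by exact: le_trans (fM 0).
rewrite -(@ler_pXn2r _ 2) ?nnegrE ?L2norm_ge0// -lee_fin L2norm_sqrE.
rewrite -[leRHS]integral_cst01.
apply: ge0_le_integral => //.
- by move=> x _; rewrite lee_fin sqr_ge0.
- by apply/measurable_EFinP; exact: measurable_funX.
- by move=> x _; rewrite lee_fin -[in leLHS](real_normK (num_real (f x))) !expr2 ler_pM.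
Qed.

End L2_basics.

(** * Completeness *)

Section riesz_fischer.
Context {R : realType}.
Local Notation mu := (mu01 R).
Local Notation T := (measurableTypeR R).
Implicit Types (f g h : L2 R) (a : R).

Lemma Lfun2_sqr (f : T -> R) : measurable_fun [set: T] f ->
  (\int[mu]_x (f x ^+ 2)%:E < +oo)%E -> f \in Lfun mu 2.
Proof.
move=> mf fy; apply/andP; split; rewrite inE//= /finite_norm unlock poweR_lty//.
rewrite (_ : (\int[mu]_x _ = \int[mu]_x (f x ^+ 2)%:E)%E)//.
by apply: eq_integral => x _ /=; rewrite powR_mulrn// real_normK// num_real.
Qed.

(** Hölder's inequality against the constant 1, whose norm is 1 because [mu01] has total mass 1. *)
Lemma L1_le_L2norm f : (\int[mu]_x `|f x|%:E <= (L2norm f)%:E)%E.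
Proof.
have h2 : (2^-1 + 2^-1 : R) = 1 by lra.
have := @hoelder _ T R mu f (cst 1) 2 2 (@L2_measurable _ f) (measurable_cst _)
  (ltr0Sn R 1) (ltr0Sn R 1) h2.
have n1 : ('N[mu]_2[EFin \o cst 1%R] = 1)%E.
  rewrite (Lnorm_cst1 mu); transitivity (1 `^ 2^-1 : \bar R)%E; last by rewrite poweR_EFin powR1.
  by congr (_ `^ _)%E; exact: mu01_setT.
rewrite Lnorm1 n1 mule1 -finite_norm_fine; apply: le_trans.
by rewrite le_eqVlt; apply/orP; left; apply/eqP; apply: eq_integral => x _ /=; rewrite mulr1.
Qed.

Lemma sum_half n : \sum_(k < n) 2^-1 ^+ k <= 2 :> R.
Proof.
suff -> : \sum_(k < n) 2^-1 ^+ k = 2 - 2 * 2^-1 ^+ n :> R.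
  by rewrite lerBlDr lerDl mulr_ge0// exprn_ge0.
elim: n => [|n IH]; first by rewrite big_ord0 expr0; ring.
by rewrite big_ord_recr /= IH exprS; field.
Qed.

Lemma limn_einf_le_near (u : (\bar R)^nat) (c : \bar R) j :
  (forall k, (j <= k)%N -> (u k <= c)%E) -> (limn_einf u <= c)%E.
Proof.
move=> uc; rewrite limn_einf_lim; apply: lime_le; first exact: is_cvg_einfs.
apply: nearW => n; apply: (@le_trans _ _ (u (maxn n j))).
  by apply: ereal_inf_lbound => /=; exists (maxn n j) => //=; exact: leq_maxl.
by apply: uc; exact: leq_maxr.
Qed.

Lemma cvg_of_dist_sum (u : nat -> R) :
  (\sum_(k <oo) `|u k.+1 - u k|%:E)%E \is a fin_num -> cvgn u.
Proof.
move=> Hf.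
have cn : cvgn (series (fun k => `|telescope u k|)).
  apply: nondecreasing_is_cvgn; first by apply: nondecreasing_series => k _ _.
  exists (fine (\sum_(k <oo) `|u k.+1 - u k|%:E)%E) => _ [n _ <-].
  rewrite -lee_fin fineK// /series /= -sumEFin.
  exact: (@nneseries_lim_ge _ (fun k => `|u k.+1 - u k|%:E) xpredT 0 n).
have /normed_cvg := cn; rewrite telescopeK => /cvg_ex [/= l cl].
apply/cvg_ex; exists (l + u 0%N).
have : (fun n => (u n - u 0%N) + u 0%N) @ \oo --> l + u 0%N.
  by apply: cvgD => //; exact: cvg_cst.
by rewrite (_ : (fun n => _ + _) = u)//; apply/funext => n; rewrite subrK.
Qed.

(** The Riesz-Fischer argument: a fast Cauchy subsequence converges almost everywhere, and Fatou's
    lemma transfers the Cauchy estimate to its limit. *)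
Lemma L2_complete (F : nat -> L2 R) :
  (forall e, 0 < e -> exists N, forall m n, (N <= m)%N -> (N <= n)%N ->
    L2norm (F m - F n) < e) ->
  exists s : L2 R, L2norm (s - F n) @[n --> \oo] --> (0 : R).
Proof.
move=> cF.
have /choice [i0 hi0] : forall k, exists N, forall m n, (N <= m)%N -> (N <= n)%N ->
    L2norm (F m - F n) < 2^-1 ^+ k.
  by move=> k; apply: cF; rewrite exprn_gt0// invr_gt0.
(* The maximum makes [ix k] at least every [i0 j] with [j <= k], although [i0], obtained by choice,
   may fail to be monotone. *)
pose ix k := (\max_(j < k.+1) i0 j)%N.
have ix_ge j k : (j <= k)%N -> (i0 j <= ix k)%N.
  move=> jk; exact: (@leq_bigmax _ (fun j : 'I_k.+1 => i0 j) (Ordinal (jk : (j < k.+1)%N))).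
pose G k := F (ix k).
have GF j k m : (j <= k)%N -> (i0 j <= m)%N -> L2norm (G k - F m) < 2^-1 ^+ j.
  by move=> jk jm; apply: hi0 => //; exact: ix_ge.
pose h k (x : T) : \bar R := `|(G k.+1 - G k) x|%:E.
have mh k : measurable_fun [set: T] (h k).
  by apply/measurable_EFinP; apply: measurableT_comp => //; exact: L2_measurable.
have h0 k x : (0 <= h k x)%E by rewrite lee_fin.
pose H x := (\sum_(k <oo) h k x)%E.
have H0 x : (0 <= H x)%E by apply: nneseries_ge0 => k _ _; exact: h0.
have mH : measurable_fun [set: T] H.
  exact: (@ge0_emeasurable_sum _ _ _ _ h xpredT (fun k x _ _ => h0 k x) (fun k _ => mh k)).
(* The increments of [G] have L1 norms at most [2^-k], so their sum is integrable, hence finite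
   almost everywhere, and there [G] converges. *)
have intH : (\int[mu]_x H x < +oo)%E.
  rewrite integral_nneseries//.
  apply: (@le_lt_trans _ _ 2%:E); last exact: ltry.
  apply: lime_le.
    by apply: is_cvg_nneseries => n _ _; exact: integral_ge0.
  apply: nearW => n; apply: (@le_trans _ _ (\sum_(k < n) (2^-1 ^+ k))%:E); last first.
    by rewrite lee_fin sum_half.
  rewrite big_mkord -sumEFin; apply: lee_sum => k _.
  apply: (le_trans (L1_le_L2norm _)); rewrite lee_fin ltW// GF//.
  exact: ix_ge.
have aeH : {ae mu, forall x, [set: T] x -> H x \is a fin_num}.
  apply: integrable_ae => //; apply/integrableP; split => //.
  by rewrite (eq_integral H)// => x _; rewrite gee0_abs.
(* The upper limit exists everywhere and is measurable; [fine] sends infinite values to 0, which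
   happens only on a null set. *)
pose s0 (x : T) : R := fine (limn_esup (fun k => (G k x)%:E)).
have ms0 : measurable_fun [set: T] s0.
  apply: (@measurableT_comp _ _ _ _ _ _ fine); first exact: fine_measurable.
  by apply: measurable_fun_limn_esup => k; apply/measurable_EFinP; exact: L2_measurable.
have cvgG : {ae mu, forall x, (fun k => G k x) @ \oo --> s0 x}.
  apply: filterS aeH => x /(_ Logic.I) /cvg_of_dist_sum /cvg_ex [/= l Gl].
  suff -> : s0 x = l by [].
  have Gl' : (fun k => (G k x)%:E) @ \oo --> l%:E.
    by apply: cvg_EFin => //; exact: nearW.
  by rewrite /s0 (cvg_limn_einf_sup Gl').2.
have sF j m : (i0 j <= m)%N ->
    (\int[mu]_x ((s0 x - F m x) ^+ 2)%:E <= ((2^-1 ^+ j) ^+ 2)%:E)%E.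
  move=> jm.
  pose u k (x : T) : \bar R := (((G k - F m) x) ^+ 2)%:E.
  have mu_ k : measurable_fun [set: T] (u k).
    by apply/measurable_EFinP; apply: measurable_funX; exact: L2_measurable.
  have u0 k x : [set: T] x -> (0 <= u k x)%E by rewrite lee_fin sqr_ge0.
  rewrite (_ : (\int[mu]_x _ = \int[mu]_x limn_einf (u ^~ x))%E); last first.
    apply: ae_eq_integral => //.
    - apply/measurable_EFinP; apply: measurable_funX; exact: measurable_funB.
    - rewrite (_ : (fun x => _) = (fun x => - limn_esup (-%E \o (u ^~ x)))%E); last first.
        by apply/funext => x; rewrite limn_esupN oppeK.
      apply: measurableT_comp => //.
      apply: (@measurable_fun_limn_esup _ _ _ _ (fun k x => - u k x)%E) => k.
      exact: measurableT_comp.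
    - apply: filterS cvgG => x Gx _.
      suff cu : u ^~ x @ \oo --> ((s0 x - F m x) ^+ 2)%:E by rewrite (cvg_limn_einf_sup cu).1.
      apply: cvg_EFin; first exact: nearW.
      apply: (@cvg_comp _ _ _ (fun k => G k x - F m x) (fun y => y ^+ 2) _ (nbhs (s0 x - F m x))).
        by apply: cvgB => //; exact: cvg_cst.
      exact: exprn_continuous.
  apply: (le_trans (fatou mu measurableT mu_ u0)).
  apply: (@limn_einf_le_near _ _ j) => k jk.
  rewrite /u -L2norm_sqrE lee_fin ler_pXn2r ?nnegrE ?L2norm_ge0//.
  by rewrite ltW// GF.
have Ls m : (i0 0%N <= m)%N -> (fun x : T => s0 x - F m x) \in Lfun mu 2.
  move=> m0; apply: Lfun2_sqr.
    by apply: measurable_funB => //; exact: L2_measurable.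
  exact: (le_lt_trans (sF _ _ m0) (ltry _)).
(* Square integrability has been shown for the difference [s0 - F m] only, so the element is built
   from the difference and [F (i0 0)] is added back. *)
pose s : L2 R := Lfun_Sub (lee1n 2) (Ls _ (leqnn _)) + F (i0 0%N).
have sE x : s x = s0 x by rewrite /s L2addE /= subrK.
have sFn j m : (i0 j <= m)%N -> L2norm (s - F m) <= 2^-1 ^+ j.
  move=> jm; rewrite -(@ler_pXn2r _ 2) ?nnegrE ?L2norm_ge0//.
  rewrite -lee_fin L2norm_sqrE; apply: le_trans (sF _ _ jm).
  by rewrite le_eqVlt; apply/orP; left; apply/eqP; apply: eq_integral => x _; rewrite -sE.
exists s; apply/cvgrPdist_le => e e0.
have : (fun j => 2^-1 ^+ j) @ \oo --> (0 : R).
  by apply: cvg_expr; rewrite ger0_norm ?invr_ge0// invf_lt1// ltr1n.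
move=> /cvgrPdist_le /(_ e e0) [j _ /(_ j (leqnn j))] /=.
rewrite sub0r normrN ger0_norm ?exprn_ge0 ?invr_ge0// => je.
near=> n; rewrite sub0r normrN ger0_norm ?L2norm_ge0//.
apply: le_trans je; apply: sFn.
by near: n; exact: nbhs_infty_ge.
Unshelve. all: by end_near. Qed.

End riesz_fischer.

(** * Density *)

(** Totality is proved by showing that a closed subspace containing the generators contains
    everything. Closedness is phrased by approximation, so [W] also absorbs elements at distance 0
    from a member, as suits a seminorm. *)
Record closed_subspace {R : realType} {V : lmodType R} (nrm : V -> R) (W : V -> Prop) := {
  closed_subspace0 : W 0;
  closed_subspaceD : forall f g, W f -> W g -> W (f + g);
  closed_subspaceZ : forall a f, W f -> W (a *: f);
  closed_subspace_lim : forall f,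
    (forall e, 0 < e -> exists2 g, W g & nrm (f - g) < e) -> W f }.

Section density.
Context {R : realType}.
Local Notation mu := (mu01 R).
Local Notation T := (measurableTypeR R).
Implicit Types (f g h : L2 R) (a : R).

Lemma Lfun2_dominated (u : T -> R) g : measurable_fun [set: T] u ->
  (forall x, `|u x| <= `|g x|) -> u \in Lfun mu 2.
Proof.
move=> mu_ ug; apply: Lfun2_sqr => //.
apply: (@le_lt_trans _ _ (\int[mu]_x (g x ^+ 2)%:E)%E); last first.
  by rewrite -L2norm_sqrE ltry.
apply: ge0_le_integral => //.
- by move=> x _; rewrite lee_fin sqr_ge0.
- by apply/measurable_EFinP; exact: measurable_funX.
- by apply/measurable_EFinP; apply: measurable_funX; exact: L2_measurable.
- move=> x _; rewrite lee_fin -(real_normK (num_real (u x))).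
  by rewrite -(real_normK (num_real (g x))) !expr2 ler_pM.
Qed.

Lemma L2_dominated_cvg f (F : nat -> L2 R) g :
  (forall n x, `|F n x| <= `|g x|) -> (forall x, F n x @[n --> \oo] --> f x) ->
  L2norm (f - F n) @[n --> \oo] --> (0 : R).
Proof.
move=> Fg Ff.
have fg x : `|f x| <= `|g x|.
  have h1 : (fun n => `|F n x|) @ \oo --> `|f x| by exact: cvg_norm (Ff x).
  have h2 : (fun n : nat => `|g x|) @ \oo --> `|g x| by exact: cvg_cst.
  by apply: (ler_cvg_to h1 h2); apply: nearW => n; exact: Fg.
pose u n (x : T) : \bar R := (((f - F n) x) ^+ 2)%:E.
have mu_ n : measurable_fun [set: T] (u n).
  by apply/measurable_EFinP; apply: measurable_funX; exact: L2_measurable.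
have u0 : {ae mu, forall x, [set: T] x -> u n x @[n --> \oo] --> (0%:E : \bar R)}.
  apply: aeW => x _; apply: cvg_EFin; first exact: nearW.
  have h : (fun n => (f x - F n x)) @ \oo --> (0 : R).
    by rewrite -(subrr (f x)); apply: cvgB; [exact: cvg_cst|exact: Ff].
  have h2 : (fun n => (f x - F n x) ^+ 2) @ \oo --> ((0 : R) ^+ 2).
    exact: (@cvg_comp _ _ _ (fun n => f x - F n x) (fun y : R => y ^+ 2) _ _ _ h
      (@exprn_continuous _ 2 0)).
  by rewrite expr0n in h2.
(* Both [f] and [F n] are bounded by [|g|], so [(2 g)^2] dominates [(f - F n)^2]. *)
pose g2 : L2 R := 2 *: g.
have ig : mu.-integrable [set: T] (EFin \o (fun x => g2 x ^+ 2)).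
  by apply: Lfun2_integrable_sqr; exact: LfunP.
have ug : {ae mu, forall x n, [set: T] x ->
    (`|u n x| <= (g2 x ^+ 2)%:E)%E}.
  apply: aeW => x n _; rewrite /u /= lee_fin ger0_norm ?sqr_ge0//.
  rewrite -(real_normK (num_real ((f - F n) x))) -[leRHS](real_normK (num_real _)).
  rewrite ler_pXn2r ?nnegrE// -[leRHS]/(`|2 * g x|) -[leLHS]/(`|f x - F n x|).
  rewrite normrM (ger0_norm (ler0n _ 2)).
  apply: (le_trans (ler_normB _ _)); rewrite [leRHS]mulr_natl [leRHS]mulr2n.
  exact: lerD.
have [_ _] := dominated_convergence measurableT mu_ (measurable_cst _) u0 ig ug.
rewrite integral0 => h.
have h2 : (fun n => L2norm (f - F n) ^+ 2) @ \oo --> (0 : R).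
  have /fine_cvg := h; apply: cvg_trans; apply: near_eq_cvg; apply: nearW => n /=.
  by rewrite -L2norm_sqrE.
apply/cvgrPdist_lt => e e0.
have e2 : 0 < e ^+ 2 by rewrite exprn_gt0.
move/cvgrPdist_lt : h2 => /(_ _ e2); apply: filterS => n.
rewrite !sub0r !normrN ger0_norm ?sqr_ge0// ger0_norm ?L2norm_ge0//.
by rewrite ltr_pXn2r ?nnegrE ?L2norm_ge0// ltW.
Qed.

Lemma Lfun2_indic (A : set T) : measurable A -> (\1_A : T -> R) \in Lfun mu 2.
Proof.
move=> mA; apply: (@bounded_Lfun2 _ _ 1); first exact: measurable_indic.
by move=> x; rewrite indicE ger0_norm// lern1 leq_b1.
Qed.

Lemma integral_mu01E (f : T -> \bar R) : measurable_fun [set: T] f ->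
  (forall x, 0 <= f x)%E ->
  (\int[mu]_x f x = \int[mu]_(x in `]0%R, 1%R[) f x)%E.
Proof.
move=> mf f0.
rewrite (@ge0_negligible_integral _ _ _ mu _ (~` `]0%R, 1%R[%classic)) ?setTD ?setCK//.
- exact: measurableC.
- by rewrite /= /mfrestr /= /mrestr setICl measure0.
Qed.

Lemma L2norm_eq0 f : (forall x, 0 < x < 1 -> f x = 0) -> L2norm f = 0.
Proof.
move=> f0; apply/eqP; rewrite -sqrf_eq0 -eqe L2norm_sqrE; apply/eqP.
rewrite integral_mu01E; last by move=> x; rewrite lee_fin sqr_ge0.
  apply: integral0_eq => x; rewrite /= in_itv /= => x01.
  by rewrite f0// expr0n.
by apply/measurable_EFinP; apply: measurable_funX; exact: L2_measurable.
Qed.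

(** Since [mu01] has no mass outside (0,1), the ray acts as (0,a) and the fundamental theorem of
    calculus applies there. *)
Lemma Rintegral_mu01_lt (f F : R -> R) a (M : R) : 0 <= a <= 1 ->
  continuous f -> (forall x : R, is_derive x 1 F (f x)) -> (forall x, `|f x| <= M) ->
  \int[mu]_x (\1_(`]-oo, a[%classic) x * f x) = F a - F 0.
Proof.
move=> /andP[a0 a1] cf dF fM.
have mf : measurable_fun [set: T] f by exact: continuous_measurable_fun.
have -> : \int[mu]_x (\1_(`]-oo, a[%classic) x * f x) = \int[mu]_(x in `]-oo, a[) f x.
  rewrite [RHS]Rintegral_mkcond; apply: eq_Rintegral => x _.
  by rewrite patchE indicE; case: ifP => _; rewrite ?mul1r ?mul0r.
rewrite /Rintegral.
have if_ : mu.-integrable `]-oo, a[ (EFin \o f).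
  apply: (@integrableS _ _ _ mu setT) => //.
  apply/Lfun1_integrable; apply: (@Lfun_subset12 _ _ _ mu).
    exact: fin_num_measure.
  exact: bounded_Lfun2 fM.
rewrite (@negligible_integral _ _ _ mu _ `]-oo, 0%R]%classic)//; last first.
  rewrite /= /mfrestr /= /mrestr (_ : _ `&` _ = set0) ?measure0//.
  apply/seteqP; split => // x /=; rewrite !in_itv /= => -[x0 /andP[x1 _]].
  by have := lt_le_trans x1 x0; rewrite ltxx.
have -> : `]-oo, a[ `\` `]-oo, 0] = `]0, a[%classic :> set R.
  apply/seteqP; split => x /=; rewrite !in_itv /= ?andbT.
    by move=> [-> /negP]; rewrite -ltNge => ->.
  by move=> /andP[x0 ->]; split => //; apply/negP; rewrite -ltNge.
rewrite (@eq_measure_integral _ _ _ _ (@lebesgue_measure R)); last first.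
  move=> A mA Aa; rewrite /= /mfrestr /= /mrestr setIidl//.
  move=> x /Aa /=; rewrite !in_itv /= => /andP[-> xa] /=.
  exact: lt_le_trans a1.
rewrite integral_itv_bndo_bndc; last first.
  by apply/measurable_EFinP; exact: measurable_funTS.
rewrite integral_itv_obnd_cbnd; last first.
  by apply/measurable_EFinP; exact: measurable_funTS.
move: a0; rewrite le_eqVlt => /predU1P[<-|a0].
  by rewrite set_itv1 integral_set1 subrr.
have cF : continuous F.
  by move=> x; apply: differentiable_continuous; apply/derivable1_diffP; have [] := dF x.
rewrite (@continuous_FTC2 _ f F)//.
- exact: continuous_subspaceT.
- split.
  + by move=> x _; have [] := dF x.
  + by apply: cvg_at_right_filter; exact: cF.
  + by apply: cvg_at_left_filter; exact: cF.
- by move=> x _; rewrite derive1E derive_val.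
Qed.

Variable W : L2 R -> Prop.
Hypothesis cW : closed_subspace (@L2norm R) W.

Lemma closed_subspace_cvg f (F : nat -> L2 R) :
  (forall n, W (F n)) -> L2norm (f - F n) @[n --> \oo] --> (0 : R) -> W f.
Proof.
move=> WF /cvgrPdist_lt Ff; apply: (closed_subspace_lim cW) => e /Ff [n _ /(_ n (leqnn n))].
by rewrite /= sub0r normrN ger0_norm ?L2norm_ge0//; exists (F n).
Qed.

Lemma closed_subspace_ae f g : W g -> (forall x, 0 < x < 1 -> f x = g x) -> W f.
Proof.
move=> Wg fg; apply: (closed_subspace_lim cW) => e e0; exists g => //.
by rewrite L2norm_eq0// => x x01; rewrite L2addE L2oppE fg// subrr.
Qed.

Hypothesis W_itv : forall f a, 0 <= a <= 1 -> f =1 \1_(`]-oo, a[%classic) -> W f.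

Lemma closed_subspace_sum I (s : seq I) (F : I -> L2 R) :
  (forall i, W (F i)) -> W (\sum_(i <- s) F i).
Proof.
by move=> WF; apply: big_ind => //; [exact: (closed_subspace0 cW)|exact: (closed_subspaceD cW)].
Qed.

Lemma closed_subspaceB f g : W f -> W g -> W (f - g).
Proof.
move=> Wf Wg; apply: (closed_subspaceD cW) => //.
by rewrite -scaleN1r; exact: (closed_subspaceZ cW).
Qed.

Lemma closed_subspace_itv f a : f =1 \1_(`]-oo, a[%classic) -> W f.
Proof.
move=> fE; pose b := Num.max 0 (Num.min a 1).
have b01 : 0 <= b <= 1.
  by rewrite /b le_max lexx /= ge_max ler01 ge_min lexx orbT.
pose g : L2 R := Lfun_Sub (lee1n 2) (@Lfun2_indic `]-oo, b[%classic (measurable_itv _)).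
apply: (@closed_subspace_ae f g); first exact: (W_itv b01).
move=> x /andP[x0 x1]; rewrite fE /g /= !indicE; congr (_%:R).
rewrite !mem_setE !in_itv /= /b lt_max lt_min x1 andbT.
by rewrite (ltNge x 0) (ltW x0).
Qed.

(** Dynkin's theorem: rays are stable under intersection and generate the Borel sets, while the sets
    with indicator in [W] are stable under complement and countable disjoint union. *)
Lemma closed_subspace_indic (A : set T) f : measurable A -> f =1 \1_A -> W f.
Proof.
move=> mA; pose P (B : set T) := forall f : L2 R, f =1 \1_B -> W f.
have WT : P setT.
  move=> g gE.
  pose g1 : L2 R :=
    Lfun_Sub (lee1n 2) (@Lfun2_indic `]-oo, 1%R[%classic (measurable_itv _)).
  apply: (@closed_subspace_ae g g1).
    by apply: (@closed_subspace_itv g1 1) => x.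
  move=> x /andP[_ x1]; by rewrite gE /g1 /= !indicE !mem_set.
suff : P A by apply.
apply: (@dynkin_induction _ T (@RGenInftyO.G R) P) => //.
- exact: RGenInftyO.measurableE.
- move=> _ _ [a ->] [b ->]; exists (Num.min a b).
  by apply/seteqP; split => x /=; rewrite !in_itv /= lt_min => /andP.
- by move=> _ [a ->] g; exact: closed_subspace_itv.
- move=> S mS PS g gE.
  pose g1 : L2 R := Lfun_Sub (lee1n 2) (Lfun2_indic mS).
  pose g2 : L2 R := Lfun_Sub (lee1n 2) (Lfun2_indic (@measurableT _ T)).
  apply: (@closed_subspace_ae g (g2 - g1)).
    by apply: closed_subspaceB; [exact: WT|exact: PS].
  move=> x _; rewrite gE L2addE L2oppE /g1 /g2 /= !indicE in_setT in_setC.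
  by case: (x \in S); rewrite ?subrr ?subr0.
- move=> F mF tF PF g gE.
  pose e k : L2 R := Lfun_Sub (lee1n 2) (Lfun2_indic (mF k)).
  pose g_ n : L2 R := \sum_(k < n) e k.
  have g_E n x : g_ n x = \sum_(k < n) \1_(F k) x by exact: (@L2sumE _ n e x).
  pose g2 : L2 R := Lfun_Sub (lee1n 2) (Lfun2_indic (@measurableT _ T)).
  (* By disjointness the partial sum at a point of [F k0] jumps once, from 0 to 1, when index [k0]
     enters; so it stays below 1 and is eventually constant. *)
  have g_in k0 n x : F k0 x -> g_ n x = (k0 < n)%:R.
    move=> Fk; rewrite g_E; elim: n => [|n IH]; first by rewrite big_ord0.
    rewrite big_ord_recr /= IH indicE; have [<-|nk] := eqVneq k0 n.
      by rewrite ltnn ltnSn mem_set// add0r.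
    rewrite ltnS [in RHS]leq_eqVlt (negbTE nk) memNset ?addr0// => Fn.
    by move/trivIsetP : tF => /(_ k0 n Logic.I Logic.I nk)/seteqP[/(_ x (conj Fk Fn))].
  have g_out n x : ~ (\bigcup_k F k) x -> g_ n x = 0.
    move=> nF; rewrite g_E big1// => i _ /=.
    by rewrite indicE memNset// => Fi; apply: nF; exists i.
  apply: (@closed_subspace_cvg _ g_).
    by move=> n; rewrite /g_ -(big_mkord xpredT); apply: closed_subspace_sum => i; exact: PF.
  apply: (@L2_dominated_cvg _ _ g2).
    move=> n x; rewrite /g2 /= indicE in_setT normr1.
    have [[k _ Fk]|nF] := pselect ((\bigcup_k F k) x); last by rewrite g_out// normr0.
    by rewrite (g_in k)// ger0_norm// lern1 leq_b1.
  move=> x; rewrite gE indicE.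
  have [[k _ Fk]|nF] := pselect ((\bigcup_k F k) x); last first.
    rewrite memNset//; under eq_fun do rewrite g_out//.
    exact: cvg_cst.
  rewrite mem_set; last by exists k.
  apply: cvg_near_cst; near=> n; rewrite (g_in k)//.
  by rewrite (_ : (k < n)%N = true)//; near: n; exact: nbhs_infty_gt.
- exact: (eq_ind _ (fun M : set (set R) => M A) mA _ (RGenInftyO.measurableE R)).
Unshelve. all: by end_near. Qed.

Import HBNNSimple.

Lemma closed_subspace_nnsfun (u : {nnsfun T >-> R}) f : f =1 u -> W f.
Proof.
move=> fE.
have mu_ y : measurable (u @^-1` [set y]) by exact: measurable_funPTI.
pose F y : L2 R := y *: (Lfun_Sub (lee1n 2) (Lfun2_indic (mu_ y)) : L2 R).
pose G : L2 R := \sum_(y <- finmap.enum_fset (fset_set (range u))) F y.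
apply: (@closed_subspace_ae f G).
  apply: closed_subspace_sum => y; apply: (closed_subspaceZ cW).
  exact: closed_subspace_indic (mu_ y) _.
move=> x _; rewrite fE fimfunE fsbig_finite//.
by rewrite (big_morph (fun f : L2 R => f x) (fun f g => L2addE f g x) (L2zeroE x)).
Qed.

Lemma closed_subspace_ge0 f : (forall x, 0 <= f x) -> W f.
Proof.
move=> f0.
have mf : measurable_fun [set: T] (EFin \o f).
  by apply/measurable_EFinP; exact: L2_measurable.
(* These simple functions increase to [f], so [f] itself dominates them. *)
pose u := nnsfun_approx measurableT mf.
have f0' x : [set: T] x -> (0 <= (EFin \o f) x)%E by rewrite lee_fin.
have uf x : (fun n => u n x) @ \oo --> f x.
  have h : (fun n => (u n x)%:E) @ \oo --> (f x)%:E.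
    exact: (@cvg_nnsfun_approx _ _ _ _ measurableT _ mf f0' x Logic.I).
  exact: (fine_cvg h).
have ule n x : `|u n x| <= `|f x|.
  rewrite !ger0_norm// -(cvg_lim _ (uf x))//.
  apply: nondecreasing_cvgn_le; last by apply/cvg_ex; exists (f x).
  by move=> m p mp; have /lefP := nd_nnsfun_approx measurableT mf mp; exact.
have Lu n : (u n : T -> R) \in Lfun mu 2 by apply: (@Lfun2_dominated _ f).
pose F n : L2 R := Lfun_Sub (lee1n 2) (Lu n).
apply: (@closed_subspace_cvg _ F); first by move=> n; exact: (@closed_subspace_nnsfun (u n)).
exact: (@L2_dominated_cvg _ _ f).
Qed.

Lemma closed_subspace_full f : W f.
Proof.
have Lp : (fun x => Num.max (f x) 0) \in Lfun mu 2.
  apply: (@Lfun2_dominated _ f); first exact: measurable_maxr.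
  by move=> x; case: (leP (f x) 0) => h; rewrite ?normr0.
have Ln : (fun x => Num.max (- f x) 0) \in Lfun mu 2.
  apply: (@Lfun2_dominated _ f); first by apply: measurable_maxr => //; exact: measurableT_comp.
  by move=> x; case: (leP (- f x) 0) => h; rewrite ?normr0 ?normrN.
pose fp : L2 R := Lfun_Sub (lee1n 2) Lp.
pose fn : L2 R := Lfun_Sub (lee1n 2) Ln.
apply: (@closed_subspace_ae _ (fp - fn)).
  by apply: closed_subspaceB; apply: closed_subspace_ge0 => x; rewrite /= le_max lexx orbT.
move=> x _; rewrite L2addE L2oppE /fp /fn /=.
by case: (leP (f x) 0); case: (leP (- f x) 0); lra.
Qed.

End density.

(** * Perturbation of an orthonormal system by dilations *)

Lemma cvg_sum0 {R : realType} n (f : nat -> nat -> R) :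
  (forall j, f j N @[N --> \oo] --> (0 : R)) ->
  \sum_(j < n) f j N @[N --> \oo] --> (0 : R).
Proof.
move=> f0; elim: n => [|n IH].
  by under eq_fun do rewrite big_ord0; exact: cvg_cst.
have h : (fun N => \sum_(j < n) f j N + f n N) @ \oo --> (0 + 0 : R).
  exact: (cvgD IH (f0 n)).
rewrite addr0 in h; rewrite (_ : (fun N => _) = fun N => \sum_(j < n) f j N + f n N)//.
by apply/funext => N; rewrite big_ord_recr.
Qed.

(** * Seminorms, closed spans and extension of Riesz bounds from finite sums *)

Section seminorm.
Context {R : realType} {V : lmodType R} (nrm : V -> R).
Hypothesis nrmD : forall f g, nrm (f + g) <= nrm f + nrm g.
Hypothesis nrmZ : forall a f, nrm (a *: f) = `|a| * nrm f.
Implicit Types (f g s : V) (phi : nat -> V) (a : nat -> R).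

Lemma nrm0 : nrm 0 = 0.
Proof. by rewrite -(scale0r 0) nrmZ normr0 mul0r. Qed.

Lemma nrmN f : nrm (- f) = nrm f.
Proof. by rewrite -scaleN1r nrmZ normrN1 mul1r. Qed.

Lemma nrmBC f g : nrm (f - g) = nrm (g - f).
Proof. by rewrite -opprB nrmN. Qed.

Lemma nrm_ge0 f : 0 <= nrm f.
Proof. by have := nrmD f (- f); rewrite subrr nrm0 nrmN; lra. Qed.

Lemma nrm_dist f g : `|nrm f - nrm g| <= nrm (f - g).
Proof.
have := nrmD (f - g) g; have := nrmD (g - f) f; rewrite !subrK (nrmBC g f).
by rewrite ler_norml; lra.
Qed.

Lemma nrm_sum n (F : nat -> V) : nrm (\sum_(i < n) F i) <= \sum_(i < n) nrm (F i).
Proof.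
elim: n => [|n IH]; first by rewrite !big_ord0 nrm0.
by rewrite !big_ord_recr /=; apply: le_trans (nrmD _ _) _; rewrite lerD2r.
Qed.

Lemma cvg_nrm f (F : nat -> V) : nrm (f - F n) @[n --> \oo] --> (0 : R) ->
  nrm (F n) @[n --> \oo] --> nrm f.
Proof.
move=> /cvgrPdist_le h; apply/cvgrPdist_le => e /h; apply: filterS => n.
by rewrite sub0r normrN (ger0_norm (nrm_ge0 _)); exact: le_trans (nrm_dist _ _).
Qed.

Lemma lincomb_widen phi a n m : (n <= m)%N ->
  lincomb phi a n = lincomb phi (fun j => if (j < n)%N then a j else 0) m.
Proof.
move=> nm; rewrite /lincomb (big_ord_widen m (fun j => a j *: phi j) nm) big_mkcond.
by apply: eq_bigr => j _; case: ifP => // _; rewrite scale0r.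
Qed.

Lemma lincombD phi a b n :
  lincomb phi (fun j => a j + b j) n = lincomb phi a n + lincomb phi b n.
Proof. by rewrite /lincomb -big_split; apply: eq_bigr => j _; rewrite scalerDl. Qed.

Lemma lincombZ phi a k n : lincomb phi (fun j => k * a j) n = k *: lincomb phi a n.
Proof. by rewrite /lincomb scaler_sumr; apply: eq_bigr => j _; rewrite scalerA. Qed.

(** The condition that [span_dense] imposes on every [f], isolated so that it can serve as the
    closed subspace [W]. *)
Definition span_closure phi f : Prop :=
  forall e, 0 < e -> exists n a, nrm (f - lincomb phi a n) < e.

Lemma span_closure0 phi : span_closure phi 0.
Proof. by move=> e e0; exists 0%N, (fun=> 0); rewrite /lincomb big_ord0 subr0 nrm0. Qed.

Lemma span_closureP phi : closed_subspace nrm (span_closure phi).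
Proof.
split.
- exact: span_closure0.
- move=> f g Wf Wg e e0; have e2 : 0 < e / 2 by rewrite divr_gt0.
  have [n [a fa]] := Wf _ e2; have [m [b gb]] := Wg _ e2.
  exists (maxn n m); pose a' j := if (j < n)%N then a j else 0.
  pose b' j := if (j < m)%N then b j else 0.
  exists (fun j => a' j + b' j); rewrite lincombD.
  rewrite -(lincomb_widen _ _ (leq_maxl n m)) -(lincomb_widen _ _ (leq_maxr n m)).
  by rewrite opprD addrACA; apply: le_lt_trans (nrmD _ _) _; rewrite (splitr e) ltrD.
- move=> k f Wf e e0.
  have k1 : 0 < `|k| + 1 by rewrite ltr_wpDl.
  have [n [a fa]] := Wf (e / (`|k| + 1)) (divr_gt0 e0 k1).
  exists n, (fun j => k * a j); rewrite lincombZ -scalerBr nrmZ.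
  rewrite ltr_pdivlMr// mulrC in fa; apply: le_lt_trans fa.
  by rewrite mulrDl mul1r lerDl nrm_ge0.
- move=> f Wf e e0; have e2 : 0 < e / 2 by rewrite divr_gt0.
  have [g Wg fg] := Wf _ e2; have [n [a ga]] := Wg _ e2.
  exists n, a; rewrite -(subrK g f) -addrA.
  by apply: le_lt_trans (nrmD _ _) _; rewrite (splitr e) ltrD.
Qed.

Lemma span_closure_mem phi j : span_closure phi (phi j).
Proof.
move=> e e0; exists j.+1, (fun i => (i == j)%:R).
rewrite /lincomb big_ord_recr /= eqxx scale1r big1 ?add0r ?subrr ?nrm0// => i _.
by rewrite ltn_eqF// scale0r.
Qed.

Lemma span_closure_sum phi n (F : nat -> V) :
  (forall i, span_closure phi (F i)) -> span_closure phi (\sum_(i < n) F i).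
Proof.
move=> WF; apply: big_ind => //; first exact: span_closure0.
exact: (closed_subspaceD (span_closureP phi)).
Qed.

(** The upper bound on a block of coefficients makes the partial sums Cauchy; completeness provides
    a sum, and both inequalities survive the limit by continuity of the seminorm. *)
Lemma riesz_bounds_finite phi (A B : R) :
  (forall F : nat -> V,
    (forall e, 0 < e -> exists N, forall m n, (N <= m)%N -> (N <= n)%N -> nrm (F m - F n) < e) ->
    exists s, nrm (s - F n) @[n --> \oo] --> (0 : R)) ->
  0 <= B ->
  (forall a n, A * \sum_(j < n) a j ^+ 2 <= nrm (lincomb phi a n) ^+ 2 <=
    B * \sum_(j < n) a j ^+ 2) ->
  riesz_bounds nrm phi A B.
Proof.
move=> complete B0 fin a sa.
have sE n : series (fun j => a j ^+ 2) n = \sum_(j < n) a j ^+ 2.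
  by rewrite /series /= big_mkord.
have sa' : (fun n => \sum_(j < n) a j ^+ 2) @ \oo --> sum_sqr a.
  by rewrite (_ : (fun n => _) = series (fun j => a j ^+ 2)) //; apply/funext => n; rewrite sE.
split.
  apply: complete => e e0.
  (* Dividing by [B + 1] covers the case [B = 0]. *)
  have e2 : 0 < e ^+ 2 / (B + 1) by rewrite divr_gt0 ?exprn_gt0// ltr_wpDl.
  move/cauchy_cvgP/cauchy_seriesP : (sa) => /(_ _ e2) [[P Q] [[N1 _ hP] [N2 _ hQ]] hN].
  suff h m n : (maxn N1 N2 <= n)%N -> (n <= m)%N ->
      nrm (lincomb phi a m - lincomb phi a n) < e.
    exists (maxn N1 N2) => m n Nm Nn; have [nm|/ltnW mn] := leqP n m; first exact: h.
    by rewrite nrmBC; exact: h.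
  rewrite geq_max => /andP[n1 n2] nm.
  (* [b] is [a] with its first [n] coefficients set to 0, written so that linearity of [lincomb]
     applies. *)
  pose b j := a j + - 1 * (if (j < n)%N then a j else 0).
  have -> : lincomb phi a m - lincomb phi a n = lincomb phi b m.
    by rewrite lincombD lincombZ -lincomb_widen// scaleN1r.
  have /andP[_ hB] := fin b m.
  have e' : \sum_(j < m) b j ^+ 2 = \sum_(n <= j < m) a j ^+ 2.
    rewrite -(big_mkord xpredT (fun j => b j ^+ 2)) (big_cat_nat (n := n))//=.
    rewrite big_nat big1 ?add0r => [|j /andP[_ jn]]; last first.
      by rewrite /b jn mulN1r subrr expr0n.
    by apply: eq_big_nat => j /andP[nj _]; rewrite /b ltnNge nj mulr0 addr0.
  have := hN (n, m) (conj (hP n n1) (hQ m (leq_trans n2 nm))) => /=.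
  rewrite ger0_norm; last by apply: sumr_ge0 => j _; exact: sqr_ge0.
  rewrite -e' ltr_pdivlMr ?ltr_wpDl// => h.
  rewrite -(@ltr_pXn2r _ 2) ?nnegrE ?nrm_ge0// ?ltW//.
  apply: (le_lt_trans hB); apply: le_lt_trans h.
  by rewrite mulrC ler_wpM2l ?lerDl//; apply: sumr_ge0 => j _; exact: sqr_ge0.
move=> s /cvg_nrm hs.
have hs2 : (fun n => nrm (lincomb phi a n) ^+ 2) @ \oo --> nrm s ^+ 2.
  exact: (@cvg_comp _ _ _ _ (fun y : R => y ^+ 2) _ _ _ hs (@exprn_continuous _ 2 _)).
split.
- apply: (ler_cvg_to (cvgMl_tmp sa') hs2); apply: nearW => n.
  by have /andP[] := fin a n.
- apply: (ler_cvg_to hs2 (cvgMl_tmp sa')); apply: nearW => n.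
  by have /andP[] := fin a n.
Qed.

(** * Bounds and span for weighted sums of odd dilations *)

Section odd_dilations.
Variables (c : R) (e phi : nat -> V).
Hypothesis c0 : 0 < c.
Let w i : R := (2 * i).+1%:R ^- 2.
Let dil N j : V := c *: \sum_(i < N) ((-1) ^+ i * w i) *: e ((2 * i).+1 * j.+1)%N.
Hypothesis phiE : forall j, nrm (phi j - dil N j) @[N --> \oo] --> (0 : R).
Hypothesis e_orthonormal : forall i n a,
  nrm (\sum_(j < n) a j *: e ((2 * i).+1 * j.+1)%N) ^+ 2 = \sum_(j < n) a j ^+ 2.

Let w0 i : 0 <= w i. Proof. by rewrite invr_ge0 exprn_ge0. Qed.

Let normw i : `|(-1) ^+ i * w i| = w i.
Proof. by rewrite normrM normrX normrN1 expr1n mul1r ger0_norm. Qed.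

Lemma odd_inv_sqr_le N : odd_inv_sqr N <= pi ^+ 2 / 8 :> R.
Proof.
rewrite -(cvg_lim _ (@cvg_odd_inv_sqr R))//; apply: nondecreasing_cvgn_le.
  apply/nondecreasing_seqP => n; rewrite /odd_inv_sqr big_ord_recr lerDl; exact: w0.
by apply/cvg_ex; exists (pi ^+ 2 / 8); exact: cvg_odd_inv_sqr.
Qed.

Lemma odd_inv_sqrS N : odd_inv_sqr N.+1 = 1 + \sum_(i < N) w i.+1 :> R.
Proof. by rewrite /odd_inv_sqr big_ord_recl /= muln0 expr1n invr1. Qed.

Lemma pi_sqr_div8_lt2 : pi ^+ 2 / 8 < 2 :> R.
Proof.
have := @pi_lt_355_113 R; have := @pi_gt0 R; move: (pi : R) => p p0 h.
nra.
Qed.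

(** In the truncations [P N], exchanging the two finite sums exposes vectors [E i] of common norm
    [al]. The partial weight sums are then bounded by pi^2/8. *)
Lemma nrm_lincomb_bounds a n :
  (c * (2 - pi ^+ 2 / 8)) ^+ 2 * \sum_(j < n) a j ^+ 2 <=
    nrm (lincomb phi a n) ^+ 2 <= (c * (pi ^+ 2 / 8)) ^+ 2 * \sum_(j < n) a j ^+ 2.
Proof.
pose E i := \sum_(j < n) a j *: e ((2 * i).+1 * j.+1)%N.
pose al := Num.sqrt (\sum_(j < n) a j ^+ 2).
have s0 : 0 <= \sum_(j < n) a j ^+ 2 by apply: sumr_ge0 => j _; exact: sqr_ge0.
have al0 : 0 <= al by exact: sqrtr_ge0.
have nE i : nrm (E i) = al.
  by rewrite /al -(e_orthonormal i n a) sqrtr_sqr ger0_norm// nrm_ge0.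
pose P N := \sum_(j < n) a j *: dil N j.
have PE N : P N = c *: \sum_(i < N) ((-1) ^+ i * w i) *: E i.
  rewrite scaler_sumr; under [RHS]eq_bigr do rewrite !scaler_sumr.
  rewrite exchange_big; apply: eq_bigr => j _; rewrite /dil scalerA scaler_sumr.
  by apply: eq_bigr => i _; rewrite !scalerA; congr (_ *: _); ring.
have cP : nrm (P N) @[N --> \oo] --> nrm (lincomb phi a n).
  apply: cvg_nrm.
  have h : (fun N => \sum_(j < n) `|a j| * nrm (phi j - dil N j)) @ \oo --> (0 : R).
    apply: (@cvg_sum0 _ n (fun j N => `|a j| * nrm (phi j - dil N j))) => j.
    by rewrite -(mulr0 `|a j|); apply: cvgMl_tmp; exact: phiE.
  apply: (squeeze_cvgr _ (cvg_cst 0) h); apply: nearW => N; rewrite nrm_ge0 /=.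
  have -> : lincomb phi a n - P N = \sum_(j < n) a j *: (phi j - dil N j).
    by rewrite /lincomb /P -sumrB; apply: eq_bigr => j _; rewrite scalerBr.
  apply: le_trans (nrm_sum n (fun j => a j *: (phi j - dil N j))) _.
  by apply: ler_sum => j _; rewrite nrmZ.
have up N : nrm (P N) <= c * odd_inv_sqr N * al.
  rewrite PE nrmZ (gtr0_norm c0) -mulrA ler_pM2l//.
  apply: le_trans (nrm_sum N (fun i => ((-1) ^+ i * w i) *: E i)) _.
  by rewrite /odd_inv_sqr mulr_suml; apply: ler_sum => i _; rewrite nrmZ normw nE.
(* With [N.+1] terms the leading one, of weight 1, is present. The others weigh
   [odd_inv_sqr N.+1 - 1] in total, which is subtracted from 1. *)
have lo N : c * (2 - odd_inv_sqr N.+1) * al <= nrm (P N.+1).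
  rewrite PE nrmZ (gtr0_norm c0) -mulrA ler_pM2l// big_ord_recl.
  have -> : (-1) ^+ (ord0 : 'I_N.+1) * w (ord0 : 'I_N.+1) = 1 :> R.
    by rewrite /= expr0 mul1r /w muln0 expr1n invr1.
  rewrite scale1r; set Q := \sum_(i < N) _.
  have hQ : nrm Q <= (\sum_(i < N) w i.+1) * al.
    apply: le_trans (nrm_sum N (fun i => ((-1) ^+ i.+1 * w i.+1) *: E i.+1)) _.
    by rewrite mulr_suml; apply: ler_sum => i _; rewrite nrmZ normw nE.
  have hE : al <= nrm (E 0%N + Q) + nrm Q.
    by rewrite -(nE 0%N) -{1}(addrK Q (E 0%N)) -[in leRHS](nrmN Q) nrmD.
  rewrite odd_inv_sqrS; move: hQ hE; set x := \sum_(i < N) w i.+1; set y := nrm (_ + _).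
  by set z := nrm Q; move=> h1 h2; rewrite (_ : (2 - (1 + x)) * al = al - x * al); [lra|ring].
have upl : nrm (lincomb phi a n) <= c * (pi ^+ 2 / 8) * al.
  apply: (ler_cvg_to cP (cvg_cst _)); apply: nearW => N; apply: (le_trans (up N)).
  by rewrite ler_wpM2r// ler_pM2l// odd_inv_sqr_le.
have lol : c * (2 - pi ^+ 2 / 8) * al <= nrm (lincomb phi a n).
  apply: (ler_cvg_to (cvg_cst _) cP); near=> N.
  have N0 : (0 < N)%N by near: N; exact: nbhs_infty_gt.
  rewrite -(prednK N0); apply: le_trans (lo N.-1).
  by rewrite ler_wpM2r// ler_pM2l// lerD2l lerN2 odd_inv_sqr_le.
have alE : \sum_(j < n) a j ^+ 2 = al ^+ 2 by rewrite sqr_sqrtr.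
have p16 := pi_sqr_div8_lt2; have p0 := @pi_gt0 R.
have k1 : 0 <= c * (2 - pi ^+ 2 / 8) * al.
  by apply: mulr_ge0 => //; apply: mulr_ge0; [exact: ltW|rewrite subr_ge0 ltW].
have k2 : 0 <= c * (pi ^+ 2 / 8) * al.
  apply: mulr_ge0 => //; apply: mulr_ge0; first exact: ltW.
  by rewrite divr_ge0// exprn_ge0// ltW.
by rewrite alE -!exprMn !ler_pXn2r ?nnegrE ?(nrm_ge0 (lincomb phi a n))// lol upl.
Unshelve. all: by end_near. Qed.

(* Solving [phi j = dil j] for its leading term shows that the largest distance
   [d] from the [e m] to the span of [phi] satisfies [d <= (pi ^+ 2 / 8 - 1) * d]. *)
Lemma span_closure_odd_dilations m : span_closure phi (e m.+1).
Proof.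
have cW := span_closureP phi.
pose q : R := pi ^+ 2 / 8 - 1.
have q0 : 0 <= q by have := odd_inv_sqr_le 1; rewrite odd_inv_sqrS big_ord0 addr0 subr_ge0.
have q1 : q < 1 by have := pi_sqr_div8_lt2; rewrite /q; lra.
(* One [d] serves all [j] at once, since the step below uses it at the odd multiples of [j.+1]. The
   slack [eps] is there because a distance need not be attained. *)
pose dist_le d := forall j eps, 0 < eps ->
  exists2 g, span_closure phi g & nrm (e j.+1 - g) <= d + eps.
have dist1 : dist_le 1.
  move=> j eps eps0; exists 0; first exact: span_closure0.
  rewrite subr0; have := e_orthonormal 0 j.+1 (fun i => (i == j)%:R).
  rewrite !big_ord_recr /= !eqxx expr1n scale1r !big1 ?add0r ?muln0 ?mul1n.
  - move=> h; suff : nrm (e j.+1) <= 1 by lra.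
    by rewrite -(@ler_pXn2r _ 2) ?nnegrE ?nrm_ge0// h expr1n.
  - by move=> i _; rewrite ltn_eqF// expr0n.
  - by move=> i _; rewrite ltn_eqF// scale0r.
have dist_step d : 0 <= d -> dist_le d -> dist_le (q * d).
  move=> d0 hd j eps eps0.
  have eps2 : 0 < eps / 2 by rewrite divr_gt0.
  have /choice [g gP] : forall i, exists g, span_closure phi g /\
      nrm (e ((2 * i.+1).+1 * j.+1)%N - g) <= d + eps / 2.
    move=> i; have [g Wg hg] := hd ((2 * i.+1).+1 * j.+1).-1%N _ eps2.
    by exists g; split => //; rewrite prednK in hg.
  have ceps : 0 < c * (eps / 2) by rewrite mulr_gt0.
  have /cvgrPdist_le /(_ _ ceps) [N0 _ /(_ N0.+1 (leqnSn N0))] := phiE j.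
  rewrite /= sub0r normrN (ger0_norm (nrm_ge0 _)) => hN.
  pose G := \sum_(i < N0) ((-1) ^+ i.+1 * w i.+1) *: g i.
  (* The truncated expansion is solved for [e j.+1], with the other [e] replaced by their
     approximants [g i]. Truncation costs at most [eps / 2] and replacement at most
     [q * (d + eps / 2)]. *)
  exists (c^-1 *: phi j - G).
    apply: (closed_subspaceD cW); first exact: (closed_subspaceZ cW _ (span_closure_mem _ _)).
    rewrite -scaleN1r; apply: (closed_subspaceZ cW).
    apply: (@span_closure_sum phi N0 (fun i => ((-1) ^+ i.+1 * w i.+1) *: g i)) => i.
    exact: (closed_subspaceZ cW _ (gP i).1).
  pose E i := e ((2 * i.+1).+1 * j.+1)%N.
  have -> : e j.+1 - (c^-1 *: phi j - G) = - (c^-1 *: (phi j - dil N0.+1 j)) -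
      \sum_(i < N0) ((-1) ^+ i.+1 * w i.+1) *: (E i - g i).
    rewrite scalerBr /dil scalerA mulVf ?gt_eqF// scale1r big_ord_recl /=.
    rewrite expr0 mul1r /w muln0 expr1n invr1 scale1r mul1n.
    rewrite [X in _ = _ - X](_ : _ = \sum_(i < N0) ((-1) ^+ i.+1 * w i.+1) *: E i - G); last first.
      by rewrite -sumrB; apply: eq_bigr => i _; rewrite scalerBr.
    rewrite -[X in - (_ - (_ + X))]/(\sum_(i < N0) ((-1) ^+ i.+1 * w i.+1) *: E i).
    set X := \sum_(i < N0) _; rewrite !opprB [G - X]addrC [RHS]addrA.
    by rewrite (addrAC (_ + X)) addrK -[RHS]addrA [- _ + G]addrC.
  apply: le_trans (nrmD _ _) _; rewrite !nrmN nrmZ gtr0_norm ?invr_gt0//.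
  have h1 : c^-1 * nrm (phi j - dil N0.+1 j) <= eps / 2 by rewrite mulrC ler_pdivrMr// mulrC.
  have h2 : nrm (\sum_(i < N0) ((-1) ^+ i.+1 * w i.+1) *: (E i - g i)) <= q * (d + eps / 2).
    apply: le_trans (nrm_sum N0 (fun i => ((-1) ^+ i.+1 * w i.+1) *: (E i - g i))) _.
    apply: (@le_trans _ _ ((\sum_(i < N0) w i.+1) * (d + eps / 2))).
      rewrite mulr_suml; apply: ler_sum => i _.
      by rewrite nrmZ normw ler_wpM2l//; exact: (gP i).2.
    apply: ler_wpM2r; first by apply: addr_ge0 => //; exact: ltW.
    by have := odd_inv_sqr_le N0.+1; rewrite odd_inv_sqrS /q; lra.
  have : q * (eps / 2) <= eps / 2 by rewrite ler_piMl// ltW.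
  by move: h1 h2; rewrite mulrDr; lra.
have dist_pow k : dist_le (q ^+ k).
  elim: k => [|k IH]; first by rewrite expr0.
  by rewrite exprS; apply: dist_step => //; rewrite exprn_ge0.
apply: (closed_subspace_lim cW) => eps eps0.
have eps2 : 0 < eps / 2 by rewrite divr_gt0.
have : (fun k => q ^+ k) @ \oo --> (0 : R) by apply: cvg_expr; rewrite ger0_norm.
move=> /cvgrPdist_lt /(_ _ eps2) [k _ /(_ k (leqnn k))] /=.
rewrite sub0r normrN ger0_norm ?exprn_ge0// => hk.
have [g Wg hg] := dist_pow k m _ eps2; exists g => //.
by apply: (le_lt_trans hg); rewrite [ltRHS]splitr ltrD2r.
Qed.

End odd_dilations.
End seminorm.

(** * The sine system *)

Section sines.
Context {R : realType}.
Local Notation mu := (mu01 R).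
Local Notation T := (measurableTypeR R).

Lemma Rintegral_mu01_eq (u v : T -> R) :
  mu.-integrable [set: T] (EFin \o u) -> mu.-integrable [set: T] (EFin \o v) ->
  (forall x, 0 < x < 1 -> u x = v x) -> \int[mu]_x u x = \int[mu]_x v x.
Proof.
move=> iu iv uv; rewrite /Rintegral; congr fine.
have m0 : mu (~` `]0%R, 1%R[%classic) = 0%E.
  by rewrite /= /mfrestr /= /mrestr setICl measure0.
have mN : measurable (~` `]0%R, 1%R[%classic : set T) by exact: measurableC.
rewrite (negligible_integral mN measurableT iu m0) (negligible_integral mN measurableT iv m0).
apply: eq_integral => x; rewrite setTD setCK inE /= in_itv /= => x01.
by rewrite uv.
Qed.

Definition sine_fun (n : nat) (x : R) : R := Num.sqrt 2 * sin (n%:R * (pi * x)).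

Lemma is_derive_sinpi (k x : R) :
  is_derive x 1 (fun y : R => sin (k * (pi * y))) (k * pi * cos (k * (pi * x))).
Proof.
rewrite (_ : (fun y => _) = fun y => sin (k * pi * y)); last by apply/funext => y; rewrite mulrA.
by rewrite (mulrA k pi x); exact: is_derive_sinM.
Qed.

Lemma is_derive_cospi (k x : R) :
  is_derive x 1 (fun y : R => cos (k * (pi * y))) (- (k * pi * sin (k * (pi * x)))).
Proof.
rewrite (_ : (fun y => _) = fun y => cos (k * pi * y)); last by apply/funext => y; rewrite mulrA.
by rewrite (mulrA k pi x); exact: is_derive_cosM.
Qed.

Lemma derive_continuous (f df : R -> R) : (forall x : R, is_derive x 1 f (df x)) -> continuous f.
Proof.
by move=> h x; apply: differentiable_continuous; apply/derivable1_diffP; have [] := h x.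
Qed.

Lemma continuous_sine_fun n : continuous (sine_fun n).
Proof. exact: (derive_continuous (fun x => is_deriveZ _ (is_derive_sinpi _ x))). Qed.

Lemma sine_fun_bound n x : `|sine_fun n x| <= Num.sqrt 2.
Proof.
by rewrite /sine_fun normrM ger0_norm ?sqrtr_ge0// ler_piMr ?sqrtr_ge0// sin_max.
Qed.

Lemma Lfun2_sine n : (sine_fun n : T -> R) \in Lfun mu 2.
Proof.
apply: bounded_Lfun2 (sine_fun_bound n).
by apply: continuous_measurable_fun; exact: continuous_sine_fun.
Qed.

Definition sine (n : nat) : L2 R := Lfun_Sub (lee1n 2) (Lfun2_sine n).

Lemma Rintegral_mu01 (f F : R -> R) (M : R) :
  continuous f -> (forall x : R, is_derive x 1 F (f x)) -> (forall x, `|f x| <= M) ->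
  \int[mu]_x f x = F 1 - F 0.
Proof.
move=> cf dF fM; have a01 : 0 <= (1 : R) <= 1 by rewrite ler01 lexx.
rewrite -(Rintegral_mu01_lt a01 cf dF fM).
have mf : measurable_fun [set: T] f by exact: continuous_measurable_fun.
apply: Rintegral_mu01_eq.
- apply/Lfun1_integrable; apply: (@Lfun_subset12 _ _ _ mu); first exact: fin_num_measure.
  exact: bounded_Lfun2 fM.
- apply/Lfun1_integrable; apply: (@Lfun_subset12 _ _ _ mu); first exact: fin_num_measure.
  apply: (@bounded_Lfun2 _ _ M).
    by apply: measurable_funM => //; exact: measurable_indic.
  move=> x; apply: le_trans (fM x); rewrite normrM indicE ler_piMl//.
  by rewrite ger0_norm// lern1 leq_b1.
- by move=> x /andP[_ x1]; rewrite indicE mem_set ?mul1r//= in_itv.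
Qed.

(** The product is a difference of cosines of frequencies [m - n] and [m + n + 2]. For [m = n] the
    first cosine is constant and needs its own antiderivative. *)
Lemma ip_sine m n : ip (sine m.+1) (sine n.+1) = (m == n)%:R.
Proof.
have p0 := @pi_gt0 R.
have s2 : Num.sqrt 2 * Num.sqrt 2 = 2 :> R by rewrite -expr2 sqr_sqrtr.
pose f x : R := sine_fun m.+1 x * sine_fun n.+1 x.
have fE x : f x = cos ((m%:R - n%:R) * (pi * x)) - cos ((m.+1%:R + n.+1%:R) * (pi * x)).
  have -> : (m%:R - n%:R) * (pi * x) = m.+1%:R * (pi * x) - n.+1%:R * (pi * x).
    by rewrite -!natr1; ring.
  rewrite (mulrDl m.+1%:R) cosB cosD /f /sine_fun.
  by rewrite mulrACA s2; ring.
have fM x : `|f x| <= Num.sqrt 2 * Num.sqrt 2.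
  by rewrite /f normrM ler_pM ?sine_fun_bound.
have cf : continuous f.
  by move=> x; apply: cvgM; exact: continuous_sine_fun.
have k0 : (m.+1%:R + n.+1%:R) * pi != 0 :> R.
  by rewrite mulf_neq0 ?gt_eqF// -natrD.
have s1 (k : nat) : sin (k%:R * (pi * 1)) = 0 :> R by rewrite mulr1 sin_natpi.
rewrite /ip -/f; have [mn|mn] := eqVneq m n.
  pose F x : R := x - ((m.+1%:R + n.+1%:R) * pi)^-1 * sin ((m.+1%:R + n.+1%:R) * (pi * x)).
  have dF (x : R) : is_derive x 1 F (f x).
    have h := is_deriveB (@is_derive_id R R x 1)
      (is_deriveZ ((m.+1%:R + n.+1%:R) * pi)^-1 (is_derive_sinpi (m.+1%:R + n.+1%:R) x)).
    refine (is_derive_eq h _).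
    have d0 : m%:R - n%:R = 0 :> R by rewrite mn subrr.
    by rewrite fE d0 mul0r cos0 /GRing.scale /= mulKf.
  rewrite (Rintegral_mu01 cf dF fM) /F.
  by rewrite -natrD s1 !mulr0 sin0 !mulr0 !subr0.
have mn0 : (m%:R - n%:R) * pi != 0 :> R.
  by rewrite mulf_eq0 (gt_eqF p0) orbF subr_eq0 eqr_nat.
pose F x : R := ((m%:R - n%:R) * pi)^-1 * sin ((m%:R - n%:R) * (pi * x)) -
  ((m.+1%:R + n.+1%:R) * pi)^-1 * sin ((m.+1%:R + n.+1%:R) * (pi * x)).
have dF (x : R) : is_derive x 1 F (f x).
  have h := is_deriveB
    (is_deriveZ ((m%:R - n%:R) * pi)^-1 (is_derive_sinpi (m%:R - n%:R) x))
    (is_deriveZ ((m.+1%:R + n.+1%:R) * pi)^-1 (is_derive_sinpi (m.+1%:R + n.+1%:R) x)).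
  refine (is_derive_eq h _).
  by rewrite fE /GRing.scale /= !mulKf.
rewrite (Rintegral_mu01 cf dF fM) /F.
rewrite -natrD s1 !mulr0 sin0 !mulr0 mulr1 mulrBl sinB !sin_natpi.
by rewrite mul0r mulr0 subrr mulr0 !subr0.
Qed.

(** Multiplication by [k.+1] is injective on positive indices, so the dilated subfamily is still
    orthonormal. *)
Lemma L2norm_sum_sine k n (a : nat -> R) :
  L2norm (\sum_(j < n) a j *: sine (k.+1 * j.+1)%N) ^+ 2 = \sum_(j < n) a j ^+ 2.
Proof.
rewrite L2norm_sqr (ip_suml n (fun j => a j *: sine (k.+1 * j.+1)%N)).
apply: eq_bigr => i _; rewrite (ip_sumr n (fun j => a j *: sine (k.+1 * j.+1)%N)).
rewrite (bigD1 i)//= big1 ?addr0 => [|j ji].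
  by rewrite ipZl ipZr -[(k.+1 * i.+1)%N]prednK// ip_sine eqxx mulr1 expr2.
rewrite ipZl ipZr -[(k.+1 * i.+1)%N]prednK// -[(k.+1 * j.+1)%N]prednK// ip_sine.
rewrite -eqSS !prednK// eqn_pmul2l// eqSS eq_sym.
by rewrite (negbTE (ji : nat_of_ord j != nat_of_ord i)) !mulr0.
Qed.

Definition itv_coef (a : R) (n : nat) : R :=
  Num.sqrt 2 * (1 - cos (n.+1%:R * (pi * a))) / (n.+1%:R * pi).

Lemma ip_itv_sine (f : L2 R) (a : R) n : 0 <= a <= 1 ->
  f =1 \1_(`]-oo, a[%classic) -> ip f (sine n.+1) = itv_coef a n.
Proof.
move=> a01 fE; have p0 := @pi_gt0 R.
have k0 : n.+1%:R * pi != 0 :> R by rewrite mulf_neq0 ?gt_eqF.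
pose F x : R := - (Num.sqrt 2 / (n.+1%:R * pi)) * cos (n.+1%:R * (pi * x)).
have dF (x : R) : is_derive x 1 F (sine_fun n.+1 x).
  have h := is_deriveZ (- (Num.sqrt 2 / (n.+1%:R * pi))) (is_derive_cospi n.+1%:R x).
  refine (is_derive_eq h _).
  by rewrite /GRing.scale /= mulrNN [LHS]mulrA divfK.
have -> : ip f (sine n.+1) = \int[mu]_x (\1_(`]-oo, a[%classic) x * sine_fun n.+1 x).
  by apply: eq_Rintegral => x _; rewrite fE.
rewrite (Rintegral_mu01_lt a01 (@continuous_sine_fun n.+1) dF (sine_fun_bound n.+1)) /F /itv_coef.
by rewrite !mulr0 cos0; ring.
Qed.

Lemma ip_itv_itv (f : L2 R) (a : R) : 0 <= a <= 1 -> f =1 \1_(`]-oo, a[%classic) -> ip f f = a.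
Proof.
move=> a01 fE; have d1 (x : R) : is_derive x 1 id (cst 1 x : R) by exact: is_derive_id.
have b1 (x : R) : `|cst 1 x : R| <= 1 by rewrite normr1.
have c1 : continuous (cst 1 : R -> R) by move=> x; exact: cvg_cst.
rewrite -[RHS]subr0 -(Rintegral_mu01_lt a01 c1 d1 b1).
by apply: eq_Rintegral => x _; rewrite fE indicE /=; case: (_ \in _); rewrite ?mulr1 ?mulr0.
Qed.

(** Parseval's identity for the indicator of (0,a): [(1 - cos u)^2 = 3/2 - 2 cos u + cos(2u)/2]
    reduces it to the cosine series at 0, [pi a] and [2 pi a]. *)
Lemma cvg_sum_itv_coef (a : R) : 0 <= a <= 1 ->
  (fun N => \sum_(n < N) itv_coef a n ^+ 2) @ \oo --> a.
Proof.
move=> /andP[a0 a1]; have p0 := @pi_gt0 R.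
have pa0 : 0 <= pi * a by rewrite mulr_ge0// ltW.
have pa1 : pi * a <= pi by rewrite ler_piMr// ltW.
have h0 := @cvg_cosine_sum R 0 (lexx _) (mulr_ge0 (ler0n _ 2) (ltW p0)).
have h1 : (fun N => cosine_sum N (pi * a)) @ \oo --> cosine_lim (pi * a).
  by apply: cvg_cosine_sum => //; lra.
have h2 : (fun N => cosine_sum N (2 * (pi * a))) @ \oo --> cosine_lim (2 * (pi * a)).
  by apply: cvg_cosine_sum; lra.
have e : a = 2 / pi ^+ 2 * (3 / 2 * cosine_lim 0 - 2 * cosine_lim (pi * a)
    + 2^-1 * cosine_lim (2 * (pi * a))).
  have pn0 : pi != 0 :> R by rewrite gt_eqF.
  by rewrite /cosine_lim; move: (pi : R) pn0 => p pn0; field.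
rewrite [X in _ --> X]e.
rewrite (_ : (fun N => _) = fun N => 2 / pi ^+ 2 * (3 / 2 * cosine_sum N 0 -
    2 * cosine_sum N (pi * a) + 2^-1 * cosine_sum N (2 * (pi * a)))).
  exact: (cvgMl_tmp (cvgD (cvgB (cvgMl_tmp h0) (cvgMl_tmp h1)) (cvgMl_tmp h2))).
apply/funext => N; rewrite /cosine_sum !mulr_sumr -sumrB -big_split /= mulr_sumr.
apply: eq_bigr => i _; rewrite mulr0 cos0 /itv_coef.
have -> : i.+1%:R * (2 * (pi * a)) = (i.+1%:R * (pi * a)) *+ 2 :> R by rewrite -mulr_natl; ring.
rewrite cos_mulr2n !exprMn sqr_sqrtr// -mulr_natl.
have k0 : i.+1%:R != 0 :> R by rewrite pnatr_eq0.
have pn0 : pi != 0 :> R by rewrite gt_eqF.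
move: (cos _) => y; move: (i.+1%:R : R) k0 (pi : R) pn0 => k k0 p pn0.
by field; rewrite k0 pn0.
Qed.

Lemma closed_subspace_sine_full (W : L2 R -> Prop) :
  closed_subspace (@L2norm R) W -> (forall n, W (sine n.+1)) -> forall f, W f.
Proof.
move=> cW We; apply: closed_subspace_full => // f a a01 fE.
pose S N : L2 R := \sum_(n < N) itv_coef a n *: sine n.+1.
have WS N : W (S N).
  apply: big_ind; [exact: (closed_subspace0 cW)|exact: (closed_subspaceD cW)|].
  by move=> n _; exact: (closed_subspaceZ cW).
have ipfS N : ip f (S N) = \sum_(n < N) itv_coef a n ^+ 2.
  rewrite (ip_sumr N (fun n => itv_coef a n *: sine n.+1)); apply: eq_bigr => n _.
  by rewrite ipZr (ip_itv_sine n a01 fE) expr2.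
have ipSS N : ip (S N) (S N) = \sum_(n < N) itv_coef a n ^+ 2.
  rewrite -L2norm_sqr -(@L2norm_sum_sine 0); congr (L2norm _ ^+ 2).
  by apply: eq_bigr => n _; rewrite mul1n.
have dist N : L2norm (f - S N) ^+ 2 = a - \sum_(n < N) itv_coef a n ^+ 2.
  rewrite L2norm_sqr !(ipDl, ipDr, ipNl, ipNr) (ipC _ f) ipfS ipSS (ip_itv_itv a01 fE).
  by ring.
apply: (closed_subspace_lim cW) => e e0.
have e2 : 0 < e ^+ 2 by rewrite exprn_gt0.
have /cvgrPdist_lt /(_ _ e2) [N _ /(_ N (leqnn N))] /= := cvg_sum_itv_coef a01.
rewrite -dist ger0_norm ?sqr_ge0// => h; exists (S N); first exact: WS.
by rewrite -(@ltr_pXn2r _ 2) ?nnegrE ?L2norm_ge0// ltW.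
Qed.

(** On a space of total mass 1 the uniform estimate [saw_sum_dist] is an estimate in norm. The sqrt
    2 inside [sine] turns 4 sqrt 6/pi^2 into sqrt 3 times 8/pi^2. *)
Lemma saw_expansion j :
  L2norm ((Num.sqrt 3 *: sawL2 j.+1 : L2 R) - (4 * Num.sqrt 6 / pi ^+ 2) *:
    \sum_(i < N) ((-1) ^+ i * (2 * i).+1%:R ^- 2) *: sine ((2 * i).+1 * j.+1)%N)
    @[N --> \oo] --> (0 : R).
Proof.
have p0 := @pi_gt0 R.
have k0 : 0 <= Num.sqrt 3 * 8 / pi ^+ 2 :> R.
  by apply: divr_ge0; [apply: mulr_ge0; rewrite ?sqrtr_ge0|rewrite exprn_ge0// ltW].
have h : (fun N => Num.sqrt 3 * 8 / pi ^+ 2 * (pi ^+ 2 / 8 - odd_inv_sqr N)) @ \oo --> (0 : R).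
  rewrite -(mulr0 (Num.sqrt 3 * 8 / pi ^+ 2)) -(subrr (pi ^+ 2 / 8)).
  apply: cvgMl_tmp; apply: cvgB; [exact: cvg_cst|exact: cvg_odd_inv_sqr].
apply: (squeeze_cvgr _ (cvg_cst 0) h); apply: nearW => N; rewrite L2norm_ge0 /=.
apply: L2norm_le_sup => x.
pose e i : L2 R := ((-1) ^+ i * (2 * i).+1%:R ^- 2) *: sine ((2 * i).+1 * j.+1)%N.
rewrite -[X in `|X|]/(Num.sqrt 3 * saw (j.+1%:R * x) -
   4 * Num.sqrt 6 / pi ^+ 2 * (\sum_(i < N) e i : L2 R) x).
rewrite L2sumE.
have -> : \sum_(i < N) e i x = Num.sqrt 2 * saw_sum N (j.+1%:R * x).
  rewrite /saw_sum mulr_sumr; apply: eq_bigr => i _.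
  rewrite -[e i x]/((-1) ^+ i * (2 * i).+1%:R ^- 2 * (Num.sqrt 2 *
    sin (((2 * i).+1 * j.+1)%:R * (pi * x)))).
  rewrite natrM mulrCA; congr (_ * (_ * sin _)); ring.
have -> : Num.sqrt 6 = Num.sqrt 3 * Num.sqrt 2 :> R by rewrite -sqrtrM// -natrM.
have s2 : Num.sqrt 2 * Num.sqrt 2 = 2 :> R by rewrite -expr2 sqr_sqrtr.
have -> : Num.sqrt 3 * saw (j.+1%:R * x) - 4 * (Num.sqrt 3 * Num.sqrt 2) / pi ^+ 2 *
    (Num.sqrt 2 * saw_sum N (j.+1%:R * x)) =
  Num.sqrt 3 * 8 / pi ^+ 2 * (pi ^+ 2 / 8 * saw (j.+1%:R * x) - saw_sum N (j.+1%:R * x)).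
  have -> : 4 * (Num.sqrt 3 * Num.sqrt 2) / pi ^+ 2 * (Num.sqrt 2 * saw_sum N (j.+1%:R * x)) =
    4 * Num.sqrt 3 / pi ^+ 2 * (Num.sqrt 2 * Num.sqrt 2) * saw_sum N (j.+1%:R * x) by ring.
  have pn0 : pi != 0 :> R by rewrite gt_eqF.
  rewrite s2; move: (saw_sum _ _) (pi : R) pn0 => y p pn0; by field.
by rewrite normrM (ger0_norm k0) ler_wpM2l// saw_sum_dist.
Qed.

End sines.

Theorem theorem2p7 (R : realType) :
  let A : R := (4 * Num.sqrt 6 / pi ^+ 2 * (2 - pi ^+ 2 / 8)) ^+ 2 in
  let B : R := 3 / 2 in
  riesz_basis (@L2norm R) (fun j : nat => Num.sqrt 3 *: sawL2 j.+1) A B /\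
  5787 / 10 ^+ 4 <= A < 5788 / 10 ^+ 4.
Proof.
move=> A B; have Ab : 5787 / 10 ^+ 4 <= A < 5788 / 10 ^+ 4 by exact: riesz_const_bounds.
split => //; have p0 := @pi_gt0 R.
have c0 : 0 < 4 * Num.sqrt 6 / pi ^+ 2 :> R.
  by rewrite divr_gt0 ?mulr_gt0 ?sqrtr_gt0 ?exprn_gt0.
have BE : (4 * Num.sqrt 6 / pi ^+ 2 * (pi ^+ 2 / 8)) ^+ 2 = B.
  have -> : 4 * Num.sqrt 6 / pi ^+ 2 * (pi ^+ 2 / 8) = Num.sqrt 6 * 2^-1 :> R.
    have pn0 : pi != 0 :> R by rewrite gt_eqF.
    by move: (pi : R) pn0 => p pn0; field.
  by rewrite exprMn sqr_sqrtr// /B; field.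
have nD := @ler_L2normD R; have nZ := @L2normZ R.
have on i n a := @L2norm_sum_sine R (2 * i) n a.
have fin := nrm_lincomb_bounds nD nZ c0 (@saw_expansion R) on.
have B0 : 0 <= B by rewrite /B divr_ge0.
split.
- apply: exprn_gt0; apply: mulr_gt0 => //; rewrite subr_gt0; exact: pi_sqr_div8_lt2.
(* [A <= B] follows by testing both bounds on a single coefficient equal to 1. *)
- have := fin (fun=> 1) 1%N; rewrite !big_ord_recr !big_ord0 /= !add0r expr1n !mulr1 => /andP[h1 h2].
  by rewrite -BE; exact: le_trans h2.
- apply: riesz_bounds_finite => //; first exact: L2_complete.
  by move=> a n; rewrite -BE; exact: fin.
- apply: closed_subspace_sine_full.
  + exact: span_closureP.
  + by move=> n; exact: (span_closure_odd_dilations nD nZ c0 (@saw_expansion R) on).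
Qed.
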